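(* Let $m\geq 2$ be an integer and let $Q_m$ be the B-spline of order $m$. For $\alpha\in\mathbb{R}$ put $$\Lambda_{\alpha}=\left\{\left\langle\tfrac{m}{2}\right\rangle+n:n\in\mathbb{N}_0\right\}\cup\left\{\alpha+\left\langle\tfrac{m}{2}\right\rangle+n:n\in\mathbb{N}^{-}\right\}.$$ Then $\Lambda_\alpha$ is a complete interpolation set for $V(Q_m)$ if and only if $|\alpha|<1/2$.
   Context: $\mathbb{N}_0=\{0,1,2,\dots\}$, $\mathbb{N}^{-}=\{-1,-2,\dots\}$, and $\langle x\rangle$ denotes the fractional part of $x$. The B-splines are defined by $Q_1=\chi_{[0,1)}$ and $Q_{m+1}(x)=\int_{-\infty}^{\infty}Q_m(x-t)Q_1(t)\,dt$; $Q_m$ is supported on $[0,m]$ and $\{Q_m(\cdot-n):n\in\mathbb{Z}\}$ is a Riesz basis of $V(Q_m)$. For $\phi\in L^2(\mathbb{R})$, $V(\phi)=\{\sum_{k\in\mathbb{Z}}c_k\phi(\cdot-k):(c_k)\in\ell^2(\mathbb{Z})\}\subset L^2(\mathbb{R})$. A countable set $\Gamma=\{x_n\}\subset\mathbb{R}$ is a set of stable sampling for $V(\phi)$ if there are constants $A,B>0$ with $A\|f\|_2^2\le\sum_n|f(x_n)|^2\le B\|f\|_2^2$ for all $f\in V(\phi)$; it is a set of interpolation if for every $(c_n)\in\ell^2$ there is $f\in V(\phi)$ with $f(x_n)=c_n$ for all $n$; it is a complete interpolation set if it is both.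
   Formalization: Λ_α is read as a family indexed by n∈Z, repeated points counted with multiplicity (as a plain set the claim fails for α=1,2,…, where Λ_α=⟨m/2⟩+Z); functions and sequences are real-valued, the complex case following by splitting real and imaginary parts. *)

(* Defs.v *)
From HB Require Import structures.
From mathcomp Require Import all_boot all_order all_algebra.
From mathcomp Require Import all_classical all_reals all_analysis.
Set Implicit Arguments. Unset Strict Implicit. Unset Printing Implicit Defensive.
Import Order.TTheory GRing.Theory Num.Theory.
Import numFieldNormedType.Exports.
Local Open Scope classical_set_scope.
Local Open Scope ring_scope.

Section Defs.
Variable R : realType.

Definition fracpart (x : R) : R := x - (Num.floor x)%:~R.

(* Bspl k = Q_(k+1):  Q_1 = chi_[0,1),
   Q_(m+1)(x) = \int_R Q_m(x - t) Q_1(t) dt  (Lebesgue integral) *)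
Definition chi01 (x : R) : R := if (0 <= x) && (x < 1) then 1 else 0.

Fixpoint Bspl (k : nat) : R -> R :=
  match k with
  | 0 => chi01
  | k'.+1 => fun x =>
      Rintegral (@lebesgue_measure R) setT
        (fun t => Bspl k' (x - t) * chi01 t)
  end.

Definition Q (m : nat) : R -> R := Bspl m.-1.

Definition l2 (c : int -> R) : Prop :=
  (\esum_(k in [set: int]) ((c k) ^+ 2)%:E < +oo)%E.

Definition psum (phi : R -> R) (c : int -> R) (x : R) (N : nat) : R :=
  \sum_(i < N) (c (i%:Z) * phi (x - (i%:Z)%:~R)
               + c (- (i.+1)%:Z) * phi (x - (- (i.+1)%:Z)%:~R)).

(* f in V(phi): f = sum_k c_k phi(. - k) with (c_k) in l^2, the series
   converging at every point (for compactly supported phi the sum is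
   locally finite). *)
Definition inV (phi : R -> R) (f : R -> R) : Prop :=
  exists c : int -> R, l2 c /\
    forall x, psum phi c x N @[N --> \oo] --> f x.

Definition L2sq (f : R -> R) : \bar R :=
  (\int[@lebesgue_measure R]_x ((f x) ^+ 2)%:E)%E.

Definition stable_sampling (phi : R -> R) (X : int -> R) : Prop :=
  exists A B : R, 0 < A /\ 0 < B /\
    forall f, inV phi f ->
      (A%:E * L2sq f <= \esum_(n in [set: int]) ((f (X n)) ^+ 2)%:E)%E /\
      (\esum_(n in [set: int]) ((f (X n)) ^+ 2)%:E <= B%:E * L2sq f)%E.

Definition interpolation (phi : R -> R) (X : int -> R) : Prop :=
  forall c : int -> R, l2 c ->
    exists f, inV phi f /\ forall n, f (X n) = c n.

Definition complete_interpolation (phi : R -> R) (X : int -> R) : Prop :=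
  stable_sampling phi X /\ interpolation phi X.

Definition Lambda (m : nat) (alpha : R) (n : int) : R :=
  if (0 <= n)%R then fracpart (m%:R / 2) + n%:~R
  else alpha + fracpart (m%:R / 2) + n%:~R.

End Defs.

(* Main.v *)
(** Write [f = \sum_k c_k Q_m(. - k)].  The samples of [f] on [Lambda] are a
paired operator applied to [c]: on the rows [n >= 0] convolution with the
symbol [\sum_j Q_m(x + j) z^j] at [x = <m/2>], on the rows [n < 0] convolution
with the symbol at [x = <m/2> + alpha].  The three-term recursion of B-splines
makes these polynomials real-rooted with interlacing negative roots, and the
sign of their values at [-1] then determines how many roots lie in the unit
disc: the right number for a Wiener-Hopf factorization of index zero, for both
symbols, exactly when [|alpha| < 1/2].  Hence the paired operator is a product
of triangular factors invertible on [l^2].  When [alpha] is a half-integer the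
symbol vanishes at [-1] and stability fails; otherwise [alpha] is an integer
translate of some [alpha0] with [|alpha0| < 1/2], and the samples on
[Lambda_alpha] are those on [Lambda_alpha0] with finitely many rows added or
removed. *)

Require Import Defs.
From HB Require Import structures.
From mathcomp Require Import all_boot all_order all_algebra.
From mathcomp Require Import all_classical all_reals all_analysis.
From mathcomp Require Import measurable_realfun ring lra zify polyrcf.
Set Implicit Arguments. Unset Strict Implicit. Unset Printing Implicit Defensive.
Import Order.TTheory GRing.Theory Num.Theory.
Import numFieldNormedType.Exports.
Local Open Scope classical_set_scope.
Local Open Scope ring_scope.

(** * Square-summable sequences indexed by the integers *)

(** Because all roots are real, no Fourier or Fredholm theory is needed: a factor [z - r] with [r]
    different from -1 is, up to a scalar and a shift, [1 - t S] with [|t| < 1], where [t] is [r] or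
    [1/r] and [S] is a unit shift, and a geometric series inverts it. Two obstacles shape the rest.
    When the order grows by one, interlacing leaves exactly one root whose position relative to -1
    is unknown, while the sign at -1 gives only a parity. Hence the induction climbs two orders at a
    time: the number of roots in the disc grows by 0, 1 or 2, and parity selects 1. Moreover
    stability is measured against the L^2 norm of [f] and not against its coefficients, so two-sided
    Riesz bounds are required. The lower one is deduced from the sampling result itself, at
    [alpha = 0]: by continuity of [Q_m], samples control [f] on short intervals up to an error small
    enough to be absorbed. *)

Definition int_enum (n : nat) : int := if odd n then Negz n./2 else Posz n./2.

Lemma int_enum_bij : set_bij [set: nat] [set: int] int_enum.
Proof.
split => // [i j _ _|[n|n] _].
- rewrite /int_enum; case: ifPn => oi; case: ifPn => oj // -[] e;
  by rewrite -[LHS]odd_double_half -[RHS]odd_double_half e ?oi ?oj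
    ?(negbTE oi) ?(negbTE oj).
- by exists n.*2 => //; rewrite /int_enum odd_double doubleK.
- by exists n.*2.+1 => //; rewrite /int_enum /= odd_double /= uphalf_double.
Qed.

Lemma esum_int (R : realType) (a : int -> \bar R) : (forall n, (0 <= a n)%E) ->
  \esum_(n in [set: int]) a n = (\sum_(i <oo) a (int_enum i))%E.
Proof.
by move=> a0; rewrite (reindex_esum [set: nat] _ int_enum) ?nneseries_esumT//;
  exact: int_enum_bij.
Qed.

Section SquareSum.
Variable R : realType.
Implicit Types (c d y : int -> R) (k r : R).

Lemma esum_intZ (a : int -> \bar R) k : (forall n, (0 <= a n)%E) -> 0 <= k ->
  (\esum_(n in [set: int]) (k%:E * a n) = k%:E * \esum_(n in [set: int]) a n)%E.
Proof.
move=> a0 k0; rewrite !esum_int//; last by move=> n; rewrite mule_ge0.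
by rewrite nneseriesZl.
Qed.

Definition sqn c : \bar R := \esum_(n in [set: int]) ((c n) ^+ 2)%:E.

Lemma l2E c : l2 c = (sqn c < +oo)%E. Proof. by []. Qed.

Let sq0 c n : (0 <= ((c n) ^+ 2)%:E)%E. Proof. by rewrite lee_fin sqr_ge0. Qed.

Lemma sqn_ge0 c : (0 <= sqn c)%E. Proof. exact: esum_ge0. Qed.

Lemma sqn_fin c : l2 c -> sqn c = (fine (sqn c))%:E.
Proof. by move=> h; rewrite fineK// ge0_fin_numE// sqn_ge0. Qed.

Lemma sqn_le_l2 c d k : (sqn c <= k%:E * sqn d)%E -> l2 d -> l2 c.
Proof. by move=> h /sqn_fin e; apply: (le_lt_trans h); rewrite e -EFinM ltry. Qed.

Lemma sqn_ge_sq c n : (((c n) ^+ 2)%:E <= sqn c)%E.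
Proof.
apply: esum_ge; exists [set n]; first by split.
by rewrite fsbig_set1.
Qed.

Lemma sqn_eq0 c : (sqn c <= 0)%E -> forall n, c n = 0.
Proof.
move=> h n; have := le_trans (sqn_ge_sq c n) h.
by rewrite lee_fin => h'; apply/eqP; rewrite -sqrf_eq0 eq_le h' sqr_ge0.
Qed.

Lemma sqn0 c : (forall n, c n = 0) -> sqn c = 0%E.
Proof. by move=> h; apply: esum1 => n _; rewrite h expr0n. Qed.

Lemma sqn_comb c d (k1 k2 : R) y : 0 <= k1 -> 0 <= k2 ->
  (forall n, (y n) ^+ 2 <= k1 * (c n) ^+ 2 + k2 * (d n) ^+ 2) ->
  (sqn y <= k1%:E * sqn c + k2%:E * sqn d)%E.
Proof.
move=> k10 k20 h; rewrite -!esum_intZ// -esumD; first last.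
- by move=> n _; rewrite mule_ge0.
- by move=> n _; rewrite mule_ge0.
by apply: le_esum => n _; rewrite -!EFinM -EFinD lee_fin.
Qed.

Lemma sqn_dom c y k : 0 <= k -> (forall n, (y n) ^+ 2 <= k * (c n) ^+ 2) ->
  (sqn y <= k%:E * sqn c)%E.
Proof.
move=> k0 h; rewrite -!esum_intZ//.
by apply: le_esum => n _; rewrite -!EFinM lee_fin.
Qed.

Lemma sqn_shift c (e : int) : sqn (fun n => c (n + e)) = sqn c.
Proof.
rewrite /sqn [RHS](reindex_esum [set: int] [set: int] (fun n => n + e))//.
split => // [i j _ _ /addIr //|n _]; exists (n - e) => //; exact: subrK.
Qed.

Lemma l2_shift c (e : int) : l2 c -> l2 (fun n => c (n + e)).
Proof. by rewrite !l2E sqn_shift. Qed.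

(** A form of Fatou's lemma: each finite partial sum passes to the limit, so pointwise convergence
    is enough. *)
Lemma sqn_fatou (u : nat -> int -> R) d (M : \bar R) :
  (forall K, (sqn (u K) <= M)%E) -> (forall n, u K n @[K --> \oo] --> d n) ->
  (sqn d <= M)%E.
Proof.
move=> hu hd; rewrite /sqn esum_int//; apply: lime_le.
  by apply: is_cvg_nneseries => n _ _.
near=> N.
case: M hu => [M| |] hu; [|by rewrite leey|].
  rewrite sumEFin lee_fin.
  have hc : (\sum_(0 <= i < N) u K (int_enum i) ^+ 2) @[K --> \oo]
       --> (\sum_(0 <= i < N) d (int_enum i) ^+ 2).
    apply: cvg_big => // [|i _]; first exact: add_continuous.
    exact: cvgM.
  rewrite -(cvg_lim _ hc)//; apply: limr_le; first by apply/cvg_ex; eexists; exact: hc.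
  near=> K; rewrite -lee_fin; apply: le_trans (hu K).
  rewrite /sqn esum_int// -sumEFin; apply: nneseries_lim_ge => i _ _; exact: sq0.
by have := le_trans (sqn_ge0 (u 0%N)) (hu 0%N).
Unshelve. all: by end_near.
Qed.

Lemma l2_comb c d : l2 c -> l2 d -> l2 (fun n => c n + d n).
Proof.
move=> hc hd; have := @sqn_comb c d 2 2 (fun n => c n + d n) ltac:(lra) ltac:(lra).
move=> /(_ _)/le_lt_trans; apply; last by rewrite (sqn_fin hc) (sqn_fin hd) -!EFinM -EFinD ltry.
by move=> n; have := sqr_ge0 (c n - d n); nra.
Qed.

Lemma l2_opp c : l2 c -> l2 (fun n => - c n).
Proof. by rewrite !l2E /sqn; under [in X in _ -> X]eq_esum do rewrite sqrrN. Qed.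

(** * First order difference operators and their products *)

Definition Op (e : int) (t : R) d : int -> R := fun n => d n - t * d (n + e).

Definition Ops (e : int) (s : seq R) d : int -> R := foldr (Op e) d s.

Definition contr (s : seq R) := all (fun t => `|t| < 1) s.

Lemma Op_comm e t e' t' d : Op e t (Op e' t' d) = Op e' t' (Op e t d).
Proof. by apply/funext => n; rewrite /Op (addrAC n e e'); ring. Qed.

Lemma Ops_comm e s e' s' d : Ops e s (Ops e' s' d) = Ops e' s' (Ops e s d).
Proof.
have h t x : Op e t (Ops e' s' x) = Ops e' s' (Op e t x).
  by elim: s' => //= t' s' IH; rewrite Op_comm IH.
by elim: s => //= t s IH; rewrite IH h.
Qed.

Lemma OpsB e s d d' :
  Ops e s (fun n => d n - d' n) = fun n => Ops e s d n - Ops e s d' n.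
Proof. by elim: s => //= t s ->; apply/funext => n; rewrite /Op; ring. Qed.

Lemma OpsZ e s (a : R) d : Ops e s (fun n => a * d n) = fun n => a * Ops e s d n.
Proof. by elim: s => //= t s ->; apply/funext => n; rewrite /Op; ring. Qed.

Lemma Ops_shift e s d (k : int) :
  Ops e s (fun n => d (n + k)) = fun n => Ops e s d (n + k).
Proof. by elim: s => //= t s ->; apply/funext => n; rewrite /Op addrAC. Qed.

Lemma sqn_Op e t d : (sqn (Op e t d) <= (2 + 2 * t ^+ 2)%:E * sqn d)%E.
Proof.
rewrite EFinD ge0_muleDl ?lee_fin//; last by rewrite mulr_ge0// sqr_ge0.
rewrite -[X in (_ <= _ + _ * X)%E](sqn_shift d e); apply: sqn_comb => //.
  by rewrite mulr_ge0// sqr_ge0.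
by move=> n; rewrite /Op; have := sqr_ge0 (d n + t * d (n + e)); nra.
Qed.

Lemma sqn_Ops e s : exists2 k : R, 0 < k & forall d, (sqn (Ops e s d) <= k%:E * sqn d)%E.
Proof.
elim: s => [|t s [k k0 IH]] /=; first by exists 1 => // d; rewrite mul1e.
have p : 0 < 2 + 2 * t ^+ 2 by have := sqr_ge0 t; lra.
exists ((2 + 2 * t ^+ 2) * k); first exact: mulr_gt0.
move=> d; apply: (le_trans (sqn_Op _ _ _)).
by rewrite EFinM -muleA; apply: lee_wpmul2l => //; rewrite lee_fin ltW.
Qed.

Lemma l2_Ops e s d : l2 d -> l2 (Ops e s d).
Proof. by have [k _ h] := sqn_Ops e s; apply: sqn_le_l2 (h d). Qed.

Lemma l2_bounded d : l2 d -> exists2 M : R, 0 <= M & forall n, `|d n| <= M.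
Proof.
move=> ld; set M := fine (sqn d); exists (M + 1).
  by have : 0 <= M; [apply: fine_ge0; exact: sqn_ge0|lra].
move=> n; have := sqn_ge_sq d n; rewrite (sqn_fin ld) lee_fin -/M.
rewrite -[d n ^+ 2]ger0_norm ?sqr_ge0// normrX => h; have := normr_ge0 (d n); nra.
Qed.

(** The solution is the Neumann series with terms [t ^+ i * y (n + e *+ i)]. It converges at each
    point because [y] is bounded; the norm bound is proved for its partial sums [u K] and passes to
    the limit by [sqn_fatou]. *)
Lemma Op_inv e t y : `|t| < 1 -> l2 y -> exists d,
  Op e t d = y /\ (sqn d <= ((1 - `|t|) ^- 2)%:E * sqn y)%E.
Proof.
move=> t1 ly; have [M M0 hM] := l2_bounded ly.
pose u (K : nat) (n : int) : R := \sum_(i < K) t ^+ i * y (n + e *+ i).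
have cu n : cvgn (u ^~ n).
  have -> : (u ^~ n) = series (fun i => t ^+ i * y (n + e *+ i)).
    by apply/funext => K; rewrite /u /series/= big_mkord.
  apply: normed_cvg; apply: (series_le_cvg (v_ := geometric M `|t|)).
  - by move=> i; exact: normr_ge0.
  - by move=> i /=; rewrite mulr_ge0// exprn_ge0.
  - by move=> i /=; rewrite normrM normrX mulrC; apply: ler_wpM2r.
  - by apply: is_cvg_geometric_series; rewrite normr_id.
pose d n := limn (u ^~ n).
have hu n : u K n @[K --> \oo] --> d n by exact: cu.
have rec K n : u K.+1 n = y n + t * u K (n + e).
  rewrite /u big_ord_recl expr0 mul1r mulr0n addr0 mulr_sumr; congr (_ + _).
  apply: eq_bigr => i _; rewrite lift0 exprS -!mulrA; congr (_ * (_ * y _)).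
  by rewrite mulrS addrA.
exists d; split.
  apply/funext => n; rewrite /Op; apply/eqP; rewrite subr_eq; apply/eqP.
  have h1 : u K.+1 n @[K --> \oo] --> d n by rewrite (cvg_shiftS (u ^~ n)); exact: hu.
  have h2 : u K.+1 n @[K --> \oo] --> y n + t * d (n + e).
    under eq_fun do rewrite rec.
    by apply: cvgD; [exact: cvg_cst|apply: cvgM; [exact: cvg_cst|exact: hu]].
  exact: cvg_unique h1 h2.
apply: (sqn_fatou (u := u)) => //.
set p := 1 - `|t|; have p0 : 0 < p by rewrite subr_gt0.
elim => [|K IH].
  rewrite sqn0 ?mule_ge0 ?sqn_ge0 ?lee_fin ?invr_ge0 ?exprn_ge0 ?(ltW p0)//.
  by move=> n; rewrite /u big_ord0.
(* Convexity with weights [p] and [|t| = 1 - p] gives (a + t b)^2 <= a^2 / p + |t| b^2. The constant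
   p^-2 is the fixed point of k = 1/p + |t| k, so it survives the induction on [K]. *)
apply: (@le_trans _ _ ((p^-1)%:E * sqn y + (`|t|)%:E * sqn (u K)))%E.
  rewrite -[X in (_ <= _ + _ * X)%E](sqn_shift (u K) e).
  apply: sqn_comb => //; first by rewrite invr_ge0 ltW.
  move=> n; rewrite rec; set a := y n; set b := u K _.
  have -> : `|t| = 1 - p by rewrite /p; ring.
  have t2 : t ^+ 2 = (1 - p) ^+ 2.
    by rewrite -[LHS]ger0_norm ?sqr_ge0// normrX /p; ring.
  rewrite -(ler_pM2l p0) [leRHS](_ : _ = a ^+ 2 + p * (1 - p) * b ^+ 2); last first.
    by field; rewrite gt_eqF.
  have h3 : 2 * (p * (a * (t * b))) <= (1 - p) * a ^+ 2 + p ^+ 2 * (1 - p) * b ^+ 2.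
    have t0 : `|t| = 1 - p by rewrite /p; ring.
    have h5 : t * (a * b) <= (1 - p) * `|a * b| by rewrite -t0 -normrM ler_norm.
    have h6 : 2 * (p * `|a * b|) <= a ^+ 2 + p ^+ 2 * b ^+ 2.
      rewrite normrM -[a ^+ 2]ger0_norm ?sqr_ge0// -[b ^+ 2]ger0_norm ?sqr_ge0//.
      by rewrite !normrX; have := sqr_ge0 (`|a| - p * `|b|); nra.
    have h7 : 0 <= 1 - p by rewrite -t0.
    have h8 : (1 - p) * (2 * (p * `|a * b|)) <= (1 - p) * (a ^+ 2 + p ^+ 2 * b ^+ 2) by apply: ler_wpM2l.
    have h9 : p * (t * (a * b)) <= p * ((1 - p) * `|a * b|) by apply: ler_wpM2l => //; exact: ltW.
    lra.
  have -> : p * (a + t * b) ^+ 2 = p * a ^+ 2 + 2 * (p * (a * (t * b))) + p * (t ^+ 2 * b ^+ 2) by ring.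
  rewrite t2; lra.
apply: (@le_trans _ _ ((p^-1)%:E * sqn y + (`|t|)%:E * ((p ^- 2)%:E * sqn y)))%E.
  by apply: leeD => //; apply: lee_wpmul2l => //; rewrite lee_fin.
rewrite muleA -EFinM -ge0_muleDl ?lee_fin ?invr_ge0 ?mulr_ge0 ?invr_ge0 ?exprn_ge0 ?(ltW p0)//.
rewrite -EFinD; suff -> : p^-1 + `|t| * p ^- 2 = p ^- 2 by [].
have -> : `|t| = 1 - p by rewrite /p; ring.
by field; rewrite gt_eqF.
Qed.

Lemma Ops_inv e s : contr s -> exists2 k : R, 0 < k & forall y, l2 y ->
  exists d, Ops e s d = y /\ (sqn d <= k%:E * sqn y)%E.
Proof.
elim: s => [_|t s IH /= /andP[t1 /IH[k k0 {}IH]]].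
  by exists 1 => // y ly; exists y; rewrite mul1e.
have p0 : 0 < (1 - `|t|) ^- 2 by rewrite invr_gt0 exprn_gt0// subr_gt0.
exists (k * (1 - `|t|) ^- 2); first exact: mulr_gt0.
move=> y ly; have [d1 [h1 h2]] := Op_inv e t1 ly.
have [d [h3 h4]] := IH d1 (sqn_le_l2 h2 ly).
exists d; split; first by rewrite h3.
apply: (le_trans h4); rewrite EFinM -muleA; apply: lee_wpmul2l => //.
by rewrite lee_fin ltW.
Qed.

Lemma Ops_local e s (P : pred int) d d' : (forall n, P n -> P (n + e)) ->
  (forall n, P n -> d n = d' n) -> forall n, P n -> Ops e s d n = Ops e s d' n.
Proof.
by move=> hP h; elim: s => //= t s IH n Pn; rewrite /Op !IH//; exact: hP.
Qed.

(** Peeling off one factor at a time, a difference [z] with [z n = t * z (n + e)] on [P] satisfies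
    |z n| <= M |t|^i for every [i], since [P] is stable under the shift and square-summable
    sequences are bounded. [P] will be a half line or all integers. *)
Lemma Ops_inj e s (P : pred int) d d' : contr s -> l2 d -> l2 d' ->
  (forall n, P n -> P (n + e)) ->
  (forall n, P n -> Ops e s d n = Ops e s d' n) -> forall n, P n -> d n = d' n.
Proof.
move=> hs ld ld' hP h.
have lx : l2 (fun n => d n - d' n) by apply: l2_comb => //; exact: l2_opp.
suff : forall n, P n -> d n - d' n = 0.
  by move=> H n Pn; apply/eqP; rewrite -subr_eq0; apply/eqP; exact: H.
have {h} : forall n, P n -> Ops e s (fun n => d n - d' n) n = 0.
  by move=> n Pn; rewrite OpsB h// subrr.
move: lx; set x := fun n => d n - d' n => lx.
rewrite -[forall n, P n -> d n - d' n = 0]/(forall n, P n -> x n = 0).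
elim: s hs => //= t s IH /andP[t1 hs] h; apply: IH => // n Pn.
have [M M0 hM] := l2_bounded (l2_Ops e s lx).
set z := Ops e s x in hM h *.
have it i : forall n, P n -> `|z n| <= M * `|t| ^+ i.
  elim: i => [|i IHi] k Pk; first by rewrite expr0 mulr1.
  have /eqP := h k Pk; rewrite /Op subr_eq0 => /eqP ->.
  rewrite normrM exprS mulrCA; apply: ler_wpM2l => //; exact/IHi/hP.
apply/eqP; rewrite -normr_le0.
have hc : M * `|t| ^+ i @[i --> \oo] --> (0 : R).
  by apply: (cvg_geometric M); rewrite normr_id.
rewrite -(cvg_lim _ hc)//; apply: limr_ge; first by apply/cvg_ex; eexists; exact: hc.
by near=> i; exact: it.
Unshelve. all: by end_near.
Qed.

Lemma sqn_glue (P : pred int) d d' k (y : int -> R) : 0 <= k ->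
  (sqn d <= k%:E * sqn y)%E -> (sqn d' <= k%:E * sqn y)%E ->
  (sqn (fun n => if P n then d n else d' n) <= (2 * k)%:E * sqn y)%E.
Proof.
move=> k0 h h'; apply: (@le_trans _ _ (1%:E * sqn d + 1%:E * sqn d')%E).
  apply: sqn_comb => // n; have := sqr_ge0 (d n); have := sqr_ge0 (d' n).
  by case: ifP => _; lra.
rewrite !mul1e (_ : 2 * k = k + k); last by ring.
by rewrite EFinD ge0_muleDl ?lee_fin//; apply: leeD.
Qed.

End SquareSum.

(** * Paired operators *)

Section Paired.
Variable R : realType.
Implicit Types (c d y : int -> R) (k r : R).
Variables uA lA uB lB : seq R.
Hypotheses (cuA : contr uA) (clA : contr lA) (cuB : contr uB) (clB : contr lB).

Definition paired c : int -> R := fun n =>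
  if 0 <= n then Ops 1 uA (Ops (-1) lA c) n else Ops 1 uB (Ops (-1) lB c) n.

Let nneg_up (n : int) : 0 <= n -> 0 <= n + 1. Proof. lia. Qed.
Let neg_down (n : int) : ~~ (0 <= n) -> ~~ (0 <= n + -1). Proof. lia. Qed.

(* On nonnegative indices an upper triangular factor only sees nonnegative
   indices, and on negative indices a lower triangular one only negative
   indices.  So the outer factors [uA], [lB] split off block-diagonally, and
   [c = lA^-1 uB^-1 d] decouples the remaining two conditions. *)
Lemma paired_surj : exists2 k : R, 0 < k & forall y, l2 y ->
  exists c, paired c = y /\ (sqn c <= k%:E * sqn y)%E.
Proof.
have [k1 k10 iuA] := Ops_inv 1 cuA; have [k2 k20 ilB] := Ops_inv (-1) clB.
have [k3 k30 buB] := sqn_Ops 1 uB; have [k4 k40 blA] := sqn_Ops (-1) lA.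
have [k5 k50 iuB] := Ops_inv 1 cuB; have [k6 k60 ilA] := Ops_inv (-1) clA.
exists (k6 * (k5 * ((2 * (k3 + k4)) * (2 * (k1 + k2))))).
  by do ![apply: mulr_gt0 => //]; lra.
move=> y ly.
have [y1 [ey1 by1]] := iuA y ly; have [y2 [ey2 by2]] := ilB y ly.
pose w (n : int) := if 0 <= n then y1 n else y2 n.
have bw : (sqn w <= (2 * (k1 + k2))%:E * sqn y)%E.
  apply: sqn_glue; first lra.
    by apply: le_trans by1 _; apply: lee_wpmul2r; [exact: sqn_ge0|rewrite lee_fin; lra].
  by apply: le_trans by2 _; apply: lee_wpmul2r; [exact: sqn_ge0|rewrite lee_fin; lra].
have lw : l2 w := sqn_le_l2 bw ly.
pose d (n : int) := if 0 <= n then Ops 1 uB w n else Ops (-1) lA w n.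
have bd : (sqn d <= (2 * (k3 + k4))%:E * sqn w)%E.
  apply: sqn_glue; first lra.
    by apply: le_trans (buB w) _; apply: lee_wpmul2r; [exact: sqn_ge0|rewrite lee_fin; lra].
  by apply: le_trans (blA w) _; apply: lee_wpmul2r; [exact: sqn_ge0|rewrite lee_fin; lra].
have ld : l2 d := sqn_le_l2 bd lw.
have [v [ev bv]] := iuB d ld; have lv : l2 v := sqn_le_l2 bv ld.
have [c [ec bc]] := ilA v lv; have lc : l2 c := sqn_le_l2 bc lv.
exists c; split; last first.
  apply: (le_trans bc); rewrite [in leRHS]EFinM -muleA; apply: lee_wpmul2l.
    by rewrite lee_fin ltW.
  apply: (le_trans bv); rewrite [in leRHS]EFinM -muleA; apply: lee_wpmul2l.
    by rewrite lee_fin ltW.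
  apply: (le_trans bd); rewrite [in leRHS]EFinM -muleA; apply: lee_wpmul2l => //.
  by rewrite lee_fin; lra.
have hv : forall n : int, 0 <= n -> v n = w n.
  apply: (Ops_inj (P := fun n : int => 0 <= n) cuB lv lw nneg_up) => n n0.
  by rewrite ev /d n0.
have hu : forall n : int, ~~ (0 <= n) -> Ops 1 uB c n = w n.
  apply: (Ops_inj (P := fun n : int => ~~ (0 <= n)) clA _ lw neg_down).
    exact: l2_Ops.
  by move=> n n0; rewrite Ops_comm ec ev /d (negbTE n0).
apply/funext => n; rewrite /paired; case: ifPn => n0.
  rewrite ec (Ops_local (P := fun n : int => 0 <= n) (d' := y1) _ nneg_up)//.
    by rewrite ey1.
  by move=> j j0; rewrite hv// /w j0.
rewrite Ops_comm (Ops_local (P := fun n : int => ~~ (0 <= n)) (d' := y2) _ neg_down)//.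
  by rewrite ey2.
by move=> j j0; rewrite hu// /w (negbTE j0).
Qed.

(** The decoupling of [paired_surj] read backwards: [uA] is cancelled on the nonnegative indices and
    [lB] on the negative ones. Then [uB] and [lA] propagate these equalities inside their half
    lines, so [uB lA c] and [uB lA c'] agree everywhere. *)
Lemma paired_inj c c' : l2 c -> l2 c' -> paired c = paired c' -> c = c'.
Proof.
move=> lc lc' e.
have l2U u x : l2 x -> l2 (Ops 1 u x) := @l2_Ops R 1 u x.
have l2L l x : l2 x -> l2 (Ops (-1) l x) := @l2_Ops R (-1) l x.
have h1 : forall n : int, 0 <= n -> Ops (-1) lA c n = Ops (-1) lA c' n.
  apply: (Ops_inj (P := fun n : int => 0 <= n) cuA (l2L _ _ lc) (l2L _ _ lc') nneg_up).
  by move=> n n0; have := congr1 (@^~ n) e; rewrite /paired n0.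
have h2 : forall n : int, ~~ (0 <= n) -> Ops 1 uB c n = Ops 1 uB c' n.
  apply: (Ops_inj (P := fun n : int => ~~ (0 <= n)) clB (l2U _ _ lc) (l2U _ _ lc') neg_down).
  by move=> n n0; have := congr1 (@^~ n) e; rewrite /paired (negbTE n0) !(Ops_comm (-1)).
have h3 n : Ops 1 uB (Ops (-1) lA c) n = Ops 1 uB (Ops (-1) lA c') n.
  have [n0|n0] := boolP (0 <= n).
    exact: (Ops_local (P := fun n : int => 0 <= n) _ nneg_up h1).
  rewrite !(Ops_comm 1).
  exact: (Ops_local (P := fun n : int => ~~ (0 <= n)) _ neg_down h2).
have h4 n : Ops (-1) lA c n = Ops (-1) lA c' n.
  exact: (Ops_inj (P := predT) cuB (l2L _ _ lc) (l2L _ _ lc') _ (fun n _ => h3 n)).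
by apply/funext => n; apply: (Ops_inj (P := predT) clA lc lc' _ (fun n _ => h4 n)).
Qed.

Lemma paired_stable : exists2 k : R, 0 < k & forall c, l2 c -> l2 (paired c) ->
  (sqn c <= k%:E * sqn (paired c))%E.
Proof.
have [k k0 h] := paired_surj; exists k => // c lc lp.
have [c' [e b]] := h _ lp.
by have <- := paired_inj (sqn_le_l2 b lp) lc e; rewrite e.
Qed.

End Paired.

(** * B-splines as differences of truncated powers *)

Section TruncatedPowers.
Variable R : realType.
Implicit Types (f g F : R -> R) (x y : R) (k m : nat).

Definition tpow k x : R := if 0 <= x then x ^+ k / k`!%:R else 0.

Definition nabla f x : R := f x - f (x - 1).

Lemma mul_tpow k x : x * tpow k x = k.+1%:R * tpow k.+1 x.
Proof.
rewrite /tpow; case: ifP => _; last by rewrite !mulr0.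
have a0 : k.+1%:R != 0 :> R by rewrite pnatr_eq0.
have b0 : k`!%:R != 0 :> R by rewrite pnatr_eq0 -lt0n fact_gt0.
rewrite factS natrM exprS; move: a0 b0; move: (k.+1%:R : R) (k`!%:R : R) => a b a0 b0.
by field; rewrite a0 b0.
Qed.

Lemma tpowS k x : tpow k.+1 x = k.+1%:R^-1 * (x * tpow k x).
Proof. by rewrite mul_tpow mulrA mulVf ?mul1r// pnatr_eq0. Qed.

Lemma tpow1E x : tpow 1 x = (x + `|x|) / 2.
Proof.
rewrite /tpow expr1 divr1; case: ifPn => [x0|].
  by rewrite ger0_norm//; field.
by rewrite -ltNge => x0; rewrite ltr0_norm// subrr mul0r.
Qed.

Lemma tpow_continuous k : continuous (tpow k.+1).
Proof.
elim: k => [|k IH] x.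
  rewrite (_ : tpow 1 = fun x => (x + `|x|) / 2); last by apply/funext => ?; exact: tpow1E.
  apply: cvgM; last exact: cvg_cst.
  by apply: cvgD; [exact: cvg_id|exact: norm_continuous].
rewrite (_ : tpow k.+2 = fun x => k.+2%:R^-1 * (x * tpow k.+1 x)); last first.
  by apply/funext => ?; exact: tpowS.
apply: cvgM; first exact: cvg_cst.
by apply: cvgM; [exact: cvg_id|exact: IH].
Qed.

(** The induction on derivatives starts here because [tpow 1] has a corner at 0. At that point the
    difference quotient of [tpow 2] equals [tpow 1 z / 2], which tends to 0. *)
Lemma is_derive_tpow2 x : is_derive x 1 (tpow 2) (tpow 1 x).
Proof.
have [x0|x0|->] := ltgtP x 0.
- have -> : tpow 1 x = 0 by rewrite /tpow leNgt x0.
  have d0 : is_derive x 1 (cst 0 : R -> R) 0 by exact: is_derive_cst.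
  apply: near_eq_is_derive d0.
  near=> z; rewrite /tpow leNgt (_ : z < 0)//.
  by near: z; exact: lt_nbhsl.
- have -> : tpow 1 x = x by rewrite /tpow (ltW x0) divr1 expr1.
  have d0 : is_derive x 1 (fun z : R => z ^+ 2 / 2) x.
    by apply: is_derive_eq; rewrite /GRing.scale/=; field.
  apply: near_eq_is_derive d0; near=> z; rewrite /tpow ltW//.
  by near: z; exact: lt_nbhsr.
have h : (fun h : R => h^-1 *: (tpow 2 (h *: 1 + 0) - tpow 2 0)) z @[z --> 0^'] --> tpow 1 0.
  have c0 : (2^-1 * tpow 1 z) @[z --> 0^'] --> tpow 1 (0 : R).
    rewrite [X in _ --> X](_ : _ = 2^-1 * tpow 1 (0:R)); last first.
      by rewrite tpow1E normr0; field.
    apply: cvgM; first exact: cvg_cst.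
    apply: cvg_within_filter. exact: tpow_continuous.
  apply: cvg_trans c0; apply: near_eq_cvg; near=> z.
  have z0 : z != 0 by near: z; exact: nbhs_dnbhs_neq.
  rewrite addr0 /GRing.scale/= mulr1 [tpow 2 z]tpowS [tpow 2 0]tpowS mul0r mulr0 subr0.
  by field.
apply: DeriveDef; first by apply/cvg_ex; eexists; exact: h.
exact: cvg_lim h.
Unshelve. all: by end_near.
Qed.

Lemma is_derive_tpow k x : is_derive x 1 (tpow k.+2) (tpow k.+1 x).
Proof.
elim: k => [|k IH]; first exact: is_derive_tpow2.
rewrite (_ : tpow k.+3 = fun x => k.+3%:R^-1 * (x * tpow k.+2 x)); last first.
  by apply/funext => ?; exact: tpowS.
apply: is_derive_eq.
rewrite /GRing.scale/= mulr1 mul_tpow [tpow k.+2 x]tpowS; field.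
by rewrite -!natr1 !gt_eqF// ?ltr_wpDl.
Qed.

Lemma nabla_continuous f : continuous f -> continuous (nabla f).
Proof.
move=> cf x; apply: cvgB; first exact: cf.
apply: (@continuous_comp _ _ _ (fun x => x - 1) f); last exact: cf.
by apply: cvgB; [exact: cvg_id|exact: cvg_cst].
Qed.

Lemma is_derive_nabla f g : (forall x, is_derive x 1 f (g x)) ->
  forall x, is_derive x 1 (nabla f) (nabla g x).
Proof.
move=> h x; have h1 := h x.
have h2 : is_derive x 1 (fun x => f (x - 1)) (g (x - 1)).
  have := @is_derive1_comp _ f (fun x => x - 1) x (g (x - 1)) 1 (h _).
  move=> /(_ _); rewrite mulr1; apply.
  by apply: is_derive_eq; rewrite subr0.
exact: is_deriveB.
Qed.

Lemma nabla_mul f : nabla (fun x => x * f x) = fun x => x * nabla f x + f (x - 1).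
Proof. by apply/funext => x; rewrite /nabla; ring. Qed.

(** The Leibniz rule for iterated differences; it has two terms because second differences of the
    identity vanish. Applied to [x * tpow m x], a multiple of [tpow m.+1 x], it gives the three-term
    recursion [Q_rec]. *)
Lemma iter_nabla_mul n f x :
  iter n.+1 nabla (fun x => x * f x) x =
  x * iter n.+1 nabla f x + n.+1%:R * iter n nabla f (x - 1).
Proof.
elim: n x => [|n IH] x; first by rewrite /= nabla_mul mul1r.
have -> : iter n.+2 nabla (fun x => x * f x) =
  nabla (fun x => x * iter n.+1 nabla f x + n.+1%:R * iter n nabla f (x - 1)).
  by rewrite iterS; congr nabla; apply/funext => y; exact: IH.
have -> : iter n.+2 nabla f x = iter n.+1 nabla f x - iter n.+1 nabla f (x - 1) by [].
have e : iter n.+1 nabla f (x - 1) = iter n nabla f (x - 1) - iter n nabla f (x - 1 - 1) by [].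
rewrite -(natr1 n.+1); move: e.
move: (iter n.+1 nabla f) (iter n nabla f) (n.+1%:R : R) => G H t e.
by rewrite /nabla e; ring.
Qed.

End TruncatedPowers.

(** * From the convolution definition to iterated differences of truncated powers *)

Section BsplineFormula.
Variable R : realType.
Implicit Types (f g F : R -> R) (x y : R) (k m : nat).
Notation mu := (@lebesgue_measure R).

(** [F] acts as an antiderivative of [f] tested on the intervals [x - 1, x]. Integrability is part
    of the notion so that the integral of a difference splits, which makes it stable under
    [nabla]. *)
Definition unit_average f F := forall x,
  mu.-integrable setT (EFin \o (fun t => f (x - t) * chi01 t)) /\
  Rintegral mu setT (fun t => f (x - t) * chi01 t) = nabla F x.

Lemma unit_average_nabla f F : unit_average f F -> unit_average (nabla f) (nabla F).
Proof.
move=> h x; have [i1 e1] := h x; have [i2 e2] := h (x - 1).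
have -> : (fun t => nabla f (x - t) * chi01 t) =
   (fun t => f (x - t) * chi01 t - f (x - 1 - t) * chi01 t).
  by apply/funext => t; rewrite /nabla (addrAC x (- 1)) mulrBl.
split; last by rewrite RintegralB// e1 e2.
exact: (integrableB measurableT i1 i2).
Qed.

Lemma chi01_indic : @chi01 R = \1_`[0, 1[ :> (R -> R).
Proof.
apply/funext => t; rewrite /chi01 indicE mem_setE in_itv/=.
by case: ifP.
Qed.

Lemma Rintegral_indic_itv (a b : R) (b0 b1 : bool) : a <= b ->
  Rintegral mu setT \1_[set` Interval (BSide b0 a) (BSide b1 b)] = b - a.
Proof.
move=> ab; rewrite /Rintegral integral_indic// setIT.
apply: (etrans (congr1 fine (lebesgue_measure_itv (Interval (BSide b0 a) (BSide b1 b))))).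
rewrite /=; case: ifP; rewrite lte_fin => //= /negbT; rewrite -leNgt => ba.
by have -> : a = b; [apply/eqP; rewrite eq_le ab|rewrite subrr].
Qed.

(** The step function [tpow 0] is discontinuous, so the integral is computed as the length of an
    interval instead of by the fundamental theorem of calculus. *)
Lemma unit_average_tpow0 : unit_average (tpow 0) (tpow 1).
Proof.
move=> x; have h : tpow 0 = (fun t => if 0 <= t then 1 else 0) :> (R -> R).
  by apply/funext => t; rewrite /tpow expr0 divr1.
rewrite h /nabla !tpow1E.
have [x0|x0] := ltP x 0.
  have -> : (fun t => (if 0 <= x - t then 1 else 0) * chi01 t) = cst 0.
    apply/funext => t; rewrite /chi01 /=; case: ifP => h1; case: ifP => h2;
      rewrite ?mulr0 ?mul0r//; lra.
  split; first exact: integrable0.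
  by rewrite Rintegral_cst// mul0r !ltr0_norm//; lra.
have [x1|x1] := ltP x 1.
  have -> : (fun t => (if 0 <= x - t then 1 else 0) * chi01 t) = \1_`[0, x].
    apply/funext => t; rewrite /chi01 indicE mem_setE in_itv/= subr_ge0.
    by case: (leP t x) => h1; case: (leP 0 t) => h2; case: (ltP t 1) => h3 //=;
      rewrite ?mulr0 ?mul0r ?mulr1//; lra.
  split; first exact: integrable_indic_itv.
  by rewrite Rintegral_indic_itv// (ger0_norm x0) ltr0_norm; lra.
have -> : (fun t => (if 0 <= x - t then 1 else 0) * chi01 t) = \1_`[0, 1[.
  apply/funext => t; rewrite /chi01 indicE mem_setE in_itv/= subr_ge0.
  by case: (leP t x) => h1; case: (leP 0 t) => h2; case: (ltP t 1) => h3 //=;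
    rewrite ?mulr0 ?mul0r ?mulr1//; lra.
split; first exact: integrable_indic_itv.
by rewrite Rintegral_indic_itv// !ger0_norm; lra.
Qed.

Lemma unit_average_tpow k : unit_average (tpow k) (tpow k.+1).
Proof.
case: k => [|k] x; first exact: unit_average_tpow0.
have cf : continuous (fun t => tpow k.+1 (x - t)).
  move=> t; apply: (@continuous_comp _ _ _ (fun t => x - t) (tpow k.+1)).
    by apply: cvgB; [exact: cvg_cst|exact: cvg_id].
  exact: tpow_continuous.
have fi : mu.-integrable `[0, 1] (EFin \o (fun t => tpow k.+1 (x - t))).
  apply: continuous_compact_integrable; first exact: segment_compact.
  exact: continuous_subspaceT.
have fi' : mu.-integrable `[0, 1[ (EFin \o (fun t => tpow k.+1 (x - t))).
  by apply: integrableS fi => //; exact: subset_itv_co_cc.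
have -> : (fun t => tpow k.+1 (x - t) * chi01 t) =
    ((fun t => tpow k.+1 (x - t)) \_ `[0, 1[).
  apply/funext => t; rewrite chi01_indic indicE patchE.
  by case: ifP => _; rewrite ?mulr1 ?mulr0.
split.
  have := (integrable_mkcond (mu := mu) (EFin \o (fun t => tpow k.+1 (x - t)))
    (measurable_itv `[(0 : R), 1[)).1 fi'.
  by rewrite restrict_EFin.
rewrite -Rintegral_mkcond Rintegral_itv_bndo_bndc//.
have dF (t : R) : is_derive t 1 (fun t => - tpow k.+2 (x - t)) (tpow k.+1 (x - t)).
  have h1 : is_derive t 1 (fun t : R => x - t) (-1).
    by apply: is_derive_eq; rewrite add0r mul1r.
  have h2 : is_derive t 1 (fun t => tpow k.+2 (x - t)) (tpow k.+1 (x - t) * (-1)).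
    by apply: is_derive1_comp; exact: is_derive_tpow.
  have := is_deriveN h2; by rewrite mulrN1 opprK.
rewrite /Rintegral (@continuous_FTC2 _ _ (fun t => - tpow k.+2 (x - t)))//.
- by rewrite -EFinB /= /nabla subr0; ring.
- exact: continuous_subspaceT.
- have cF : continuous (fun t => - tpow k.+2 (x - t)).
    by move=> t; apply/differentiable_continuous/derivable1_diffP; have [] := dF t.
  split => [t _| |]; first by have [] := dF t.
    exact/cvg_at_right_filter/cF.
  exact/cvg_at_left_filter/cF.
- by move=> t _; rewrite derive1E; have [_ ->] := dF t.
Qed.

Lemma BsplE k : @Bspl R k = iter k.+1 (@nabla R) (tpow k).
Proof.
elim: k => [|k IH].
  apply/funext => x; rewrite /= /nabla /tpow /chi01 !expr0 !divr1 subr_ge0.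
  by case: (leP 0 x) => h1; case: (ltP x 1) => h2; rewrite /= ?subr0 ?subrr//; lra.
apply/funext => x; rewrite [LHS]/= IH.
suff h n : unit_average (iter n (@nabla R) (tpow k)) (iter n (@nabla R) (tpow k.+1)).
  by have [_ ->] := h k.+1 x.
elim: n => [|n]; first exact: unit_average_tpow.
by rewrite !iterS; exact: unit_average_nabla.
Qed.

End BsplineFormula.

(** * Recursion, support, symmetry, and the sign of the symbol at -1 *)

Section BsplineProperties.
Variable R : realType.
Implicit Types (f g F : R -> R) (x y : R) (k m : nat).
Notation Q := (@Q R).

Lemma QE m : Q m.+1 = iter m.+1 (@nabla R) (tpow m).
Proof. exact: BsplE. Qed.

Lemma iter_nablaZ n (a : R) f :
  iter n (@nabla R) (fun x => a * f x) = fun x => a * iter n (@nabla R) f x.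
Proof.
elim: n => // n IH; rewrite [LHS]iterS IH; apply/funext => x.
by rewrite /= /nabla mulrBr.
Qed.

Lemma Q_rec m x :
  m.+1%:R * Q m.+2 x = x * Q m.+1 x + (m.+2%:R - x) * Q m.+1 (x - 1).
Proof.
have -> : m.+1%:R * Q m.+2 x =
    iter m.+2 (@nabla R) (fun x => m.+1%:R * tpow m.+1 x) x.
  by rewrite iter_nablaZ QE.
have -> : (fun x : R => m.+1%:R * tpow m.+1 x) = (fun x => x * tpow m x).
  by apply/funext => y; rewrite mul_tpow.
rewrite iter_nabla_mul -!QE.
have -> : iter m.+2 (@nabla R) (tpow m) x = Q m.+1 x - Q m.+1 (x - 1) by rewrite QE.
ring.
Qed.

Lemma Q_recV m x :
  Q m.+2 x = (x * Q m.+1 x + (m.+2%:R - x) * Q m.+1 (x - 1)) / m.+1%:R.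
Proof. by rewrite -Q_rec mulrC mulKf// pnatr_eq0. Qed.

Lemma Q_lt0 m x : x < 0 -> Q m.+1 x = 0.
Proof.
elim: m x => [|m IH] x x0; first by rewrite /Q /= /chi01 leNgt x0.
by rewrite Q_recV !IH ?mulr0 ?addr0 ?mul0r//; lra.
Qed.

Lemma Q_le0 m x : x <= 0 -> Q m.+2 x = 0.
Proof.
rewrite le_eqVlt => /predU1P[->|/Q_lt0 //].
by rewrite Q_recV mul0r (Q_lt0 m (_ : 0 - 1 < 0)) ?mulr0 ?addr0 ?mul0r//; lra.
Qed.

Lemma Q_ge m x : m.+1%:R <= x -> Q m.+1 x = 0.
Proof.
elim: m x => [|m IH] x x0.
  by rewrite /Q /= /chi01 [x < 1]ltNge x0 andbF.
by move: x0; rewrite -natr1 => x0; rewrite Q_recV !IH ?mulr0 ?addr0 ?mul0r//; lra.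
Qed.

Lemma Q2_left x : 0 <= x <= 1 -> Q 2 x = x.
Proof.
move=> /andP[x0]; rewrite Q_recV divr1 le_eqVlt => /predU1P[->|x1].
  by rewrite subrr /Q /= /chi01 ltxx lexx ltr01 andbF mulr0 add0r mulr1; ring.
rewrite (@Q_lt0 0 (x - 1)) ?subr_lt0// mulr0 addr0.
by rewrite /Q /= /chi01 x0 x1 mulr1.
Qed.

Lemma Q2_right x : 1 <= x <= 2 -> Q 2 x = 2 - x.
Proof.
move=> /andP[x1 x2]; rewrite Q_recV divr1 (@Q_ge 0 x x1) mulr0 add0r.
have [->|x2'] := eqVneq x 2; first by rewrite subrr mul0r.
rewrite /Q /= /chi01 subr_ge0 x1 (_ : x - 1 < 1) ?mulr1//.
by rewrite ltrBlDr lt_neqAle x2'.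
Qed.

(** The induction starts at order 2: the half-open interval of [Q 1] breaks the symmetry at the end
    points. *)
Lemma Q_sym m x : Q m.+2 (m.+2%:R - x) = Q m.+2 x.
Proof.
elim: m x => [|m IH] x.
  have [x0|x0] := ltP x 0; first by rewrite (Q_lt0 _ x0) Q_ge//; lra.
  have [x2|x2] := ltP 2 x; first by rewrite (@Q_ge 1 x (ltW x2)) Q_lt0//; lra.
  have [x1|x1] := leP x 1; first by rewrite Q2_right ?(Q2_left (x := x)); lra.
  by rewrite Q2_left ?(Q2_right (x := x)); lra.
rewrite Q_recV [RHS]Q_recV; congr (_ / _).
have -> : m.+3%:R - x = m.+2%:R - (x - 1) :> R by rewrite -(natr1 m.+2); ring.
rewrite IH; have -> : m.+2%:R - (x - 1) - 1 = m.+2%:R - x :> R by ring.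
by rewrite IH -(natr1 m.+2); ring.
Qed.

Lemma Q_continuous m : continuous (Q m.+2).
Proof.
rewrite QE; move: m.+2 (@tpow_continuous R m) => n; elim: n => // n IH h.
by rewrite iterS; apply/nabla_continuous/IH.
Qed.

Lemma is_derive_Q m x : is_derive x 1 (Q m.+3) (nabla (Q m.+2) x).
Proof.
rewrite !QE -iterS; move: m.+3 (@is_derive_tpow R m) x => n.
elim: n => // n IH h x; rewrite !iterS; apply: is_derive_nabla.
Qed.

Lemma Q_bounded m : exists2 M : R, 0 <= M & forall x, `|Q m.+1 x| <= M.
Proof.
elim: m => [|m [M M0 IH]].
  by exists 1 => // x; rewrite /Q /= /chi01; case: ifP; rewrite ?normr1 ?normr0.
exists (m.+2%:R * M + m.+2%:R * M); first by rewrite addr_ge0// mulr_ge0.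
move=> x.
have [x0|x0] := ltP x 0; first by rewrite Q_lt0// normr0 addr_ge0// mulr_ge0.
have [x1|x1] := leP m.+2%:R x; first by rewrite Q_ge// normr0 addr_ge0// mulr_ge0.
rewrite Q_recV normrM [X in _ * X]ger0_norm ?invr_ge0//.
rewrite ler_pdivrMr ?ltr0n//; apply: (@le_trans _ _ (m.+2%:R * M + m.+2%:R * M)).
  apply: (le_trans (ler_normD _ _)); apply: lerD; rewrite normrM; apply: ler_pM => //.
    by rewrite ger0_norm// ltW.
  by rewrite ger0_norm; lra.
by rewrite ler_peMr ?addr_ge0 ?mulr_ge0// ler1n.
Qed.

(* The symbol [\sum_j Q_m (x + j) z^j] at [z = -1]. *)
Definition gsum m x : R := \sum_(j < m) (-1) ^+ j * Q m (x + j%:R).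

Lemma gsum_sym m x : gsum m.+2 (1 - x) = (-1) ^+ m.+1 * gsum m.+2 x.
Proof.
rewrite /gsum mulr_sumr (reindex_inj rev_ord_inj)/=; apply: eq_bigr => j _.
have jm : (j <= m.+1)%N by rewrite -ltnS.
have -> : (-1) ^+ m.+1 = (-1) ^+ (m.+1 - j) * (-1) ^+ j :> R by rewrite -exprD subnK.
rewrite subSS -mulrA [X in _ = _ * X]mulrA -expr2 sqrr_sign mul1r.
by rewrite -Q_sym natrB// -!(natr1 m.+1); congr (_ * Q _ _); ring.
Qed.

Lemma gsum0 m : gsum m.+2 0 = - gsum m.+2 1.
Proof.
rewrite /gsum big_ord_recl /= expr0 add0r [Q _ 0]Q_le0// mulr0 add0r.
rewrite [X in _ = - X]big_ord_recr/= [Q _ (1 + m.+1%:R)]Q_ge ?mulr0 ?addr0; last by rewrite nat1r.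
rewrite -sumrN; apply: eq_bigr => j _.
by rewrite -[bump 0 j]/(j.+1) exprS mulN1r mulNr add0r nat1r.
Qed.

(** The derivative of a B-spline is a backward difference; under alternating signs its two halves
    reinforce each other, whence the factor 2. *)
Lemma is_derive_gsum m x : 0 <= x <= 1 ->
  is_derive x 1 (gsum m.+3) (2 * gsum m.+2 x).
Proof.
move=> x01.
have -> : 2 * gsum m.+2 x = \sum_(j < m.+3) (-1) ^+ j * nabla (Q m.+2) (x + j%:R).
  under eq_bigr do rewrite /nabla mulrBr; rewrite sumrB.
  (* The boundary terms at [x + m.+2] and at [x - 1] lie outside the open support because
     [0 <= x <= 1]; this allows the two sums to be realigned. *)
  rewrite big_ord_recr/= [Q _ (x + m.+2%:R)]Q_ge; last lra.
  rewrite mulr0 addr0 [X in _ - X]big_ord_recl/= [Q _ (x + 0 - 1)]Q_le0; last lra.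
  rewrite mulr0 add0r -/(gsum m.+2 x) mulr2n mulrDl mul1r; congr (_ + _).
  rewrite /gsum -sumrN; apply: eq_bigr => j _.
  rewrite -[bump 0 j]/(j.+1) exprS mulN1r mulNr opprK -natr1; congr (_ * Q _ _); ring.
have -> : gsum m.+3 = \sum_(j < m.+3) (fun x => (-1) ^+ j * Q m.+3 (x + j%:R)).
  by apply/funext => y; rewrite fct_sumE.
apply: is_derive_sum => j.
have h1 : is_derive x 1 (fun x : R => x + j%:R) 1.
  by apply: is_derive_eq; rewrite addr0.
have h2 : is_derive x 1 (fun x => Q m.+3 (x + j%:R)) (nabla (Q m.+2) (x + j%:R) * 1).
  by apply: is_derive1_comp; exact: is_derive_Q.
by rewrite mulr1 in h2; exact: (is_deriveZ ((-1) ^+ j) h2).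
Qed.

Lemma gsum_MVT m x y : 0 <= x -> x < y -> y <= 1 -> exists2 z, x < z < y &
  gsum m.+3 y - gsum m.+3 x = 2 * gsum m.+2 z * (y - x).
Proof.
move=> x0 xy y1.
have d z : x <= z <= y -> is_derive z 1 (gsum m.+3) (2 * gsum m.+2 z).
  by move=> /andP[xz zy]; apply: is_derive_gsum; lra.
have [|z|c cxy e] := @MVT _ (gsum m.+3) (fun z => 2 * gsum m.+2 z) x y xy.
- by move=> z; rewrite in_itv/= => /andP[xz zy]; apply: d; lra.
- apply: derivable_within_continuous => t; rewrite in_itv/= => /d h; exact: ex_derive.
by exists c.
Qed.

Lemma gsum_half p : gsum p.*2.+2 (1 / 2) = 0.
Proof.
have := gsum_sym p.*2 (1 / 2); rewrite exprS -signr_odd odd_double /= mulr1.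
by rewrite (_ : 1 - 1 / 2 = 1 / 2); lra.
Qed.

Lemma gsum_odd_sym q x : gsum q.*2.+3 (1 - x) = gsum q.*2.+3 x.
Proof. by rewrite gsum_sym -signr_odd /= odd_double /= mul1r. Qed.

Lemma gsum_odd0 q : gsum q.*2.+3 0 = 0.
Proof. by have := gsum0 q.*2.+1; rewrite -[in RHS](gsum_odd_sym q 1) subrr; lra. Qed.

(** On [0, 1], for m >= 2, [gsum m] is the Euler polynomial E_(m-1) times 2^(m-1) / (m-1)!. Even
    orders vanish at 1/2 and odd orders at 0 and 1, so the sign of each order follows from that of
    its derivative, the previous order, by the mean value theorem started at such a zero. *)
Lemma sign_gsum p :
  (forall x, 0 <= x < 1 / 2 -> 0 < (-1) ^+ p.+1 * gsum p.*2.+2 x) /\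
  (forall x, 0 < x < 1 -> 0 < (-1) ^+ p.+1 * gsum p.*2.+3 x).
Proof.
have step q : (forall x, 0 <= x < 1 / 2 -> 0 < (-1) ^+ q.+1 * gsum q.*2.+2 x) ->
    forall x, 0 < x < 1 -> 0 < (-1) ^+ q.+1 * gsum q.*2.+3 x.
  move=> hq.
  have half x : 0 < x <= 1 / 2 -> 0 < (-1) ^+ q.+1 * gsum q.*2.+3 x.
    move=> /andP[x0 x1]; have x1' : x <= 1 by lra.
    have [z /andP[z0 zx] e] := gsum_MVT q.*2 (lexx 0) x0 x1'.
    rewrite (_ : gsum _ x = gsum q.*2.+2 z * (2 * x)); last first.
      by move: e; rewrite gsum_odd0 !subr0 => ->; ring.
    by clear e; rewrite (mulrA ((-1) ^+ q.+1)); apply: mulr_gt0; [apply: hq; lra|lra].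
  move=> x /andP[x0 x1]; have [h|h] := leP x (1 / 2); first by apply: half; lra.
  by rewrite -gsum_odd_sym; apply: half; lra.
elim: p => [|p [_ IH]].
  have E0 x : 0 <= x < 1 / 2 -> 0 < (-1) ^+ 1 * gsum 2 x.
    move=> /andP[x0 x1]; rewrite /gsum !big_ord_recl big_ord0 /= expr0 mul1r addr0.
    rewrite -[bump 0 0]/1%N ?expr1 ?addr0 -(Q_sym 0 (x + 1)). rewrite !Q2_left; lra.
  by split; [exact: E0|exact: step].
have E x : 0 <= x < 1 / 2 -> 0 < (-1) ^+ p.+2 * gsum p.+1.*2.+2 x.
  move=> /andP[x0 x1]; have h1 : 1 / 2 <= 1 :> R by lra.
  have [z /andP[z0 zx] e] := gsum_MVT p.*2.+1 x0 x1 h1.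
  rewrite doubleS (_ : gsum _ x = - (gsum p.*2.+3 z * (2 * (1 / 2 - x)))); last first.
    by move: e; rewrite -[p.*2.+4]/(p.+1.*2.+2) gsum_half sub0r => /eqP; rewrite eqr_oppLR => /eqP ->; ring.
  rewrite exprS mulN1r mulrNN (mulrA ((-1) ^+ p.+1)).
  by clear e; apply: mulr_gt0; [apply: IH; lra|lra].
by split; [exact: E|exact: step].
Qed.

Lemma sign_gsum_right p x : 1 / 2 < x <= 1 -> 0 < (-1) ^+ p * gsum p.*2.+2 x.
Proof.
move=> x01; have [h _] := sign_gsum p; have := h (1 - x) ltac:(lra).
have e : (-1) ^+ p.*2.+1 = -1 :> R by rewrite exprS -signr_odd odd_double mulr1.
by rewrite gsum_sym e exprS !mulN1r mulrNN.
Qed.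

End BsplineProperties.

(** * Interlacing of real roots *)

Section Interlacing.
Variable R : rcfType.
Implicit Types (r f : nat -> R) (d n : nat).

Definition rprod d r : {poly R} := \prod_(0 <= j < d) ('X - (r j)%:P).

Lemma sign_prod_neg n m f : (n <= m)%N ->
  (forall j, (n <= j < m)%N -> f j < 0) -> 0 < (-1) ^+ (m - n) * \prod_(n <= j < m) f j.
Proof.
elim: m => [|m IH] nm h.
  by rewrite big_geq ?sub0n ?expr0 ?mulr1.
have [e|ltnm] := eqVneq n m.+1; first by rewrite e subnn big_geq// expr0 mulr1.
have {}nm : (n <= m)%N by lia.
rewrite big_nat_recr//= subSn// exprS mulN1r mulNr mulrA -mulrN.
apply: mulr_gt0; first by apply: IH => // j hj; apply: h; lia.
by rewrite oppr_gt0; apply: h; lia.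
Qed.

Lemma prod_nat_gt0 n m f :
  (forall j, (n <= j < m)%N -> 0 < f j) -> 0 < \prod_(n <= j < m) f j.
Proof. by move=> h; rewrite big_seq prodr_gt0// => j; rewrite mem_index_iota; exact: h. Qed.

Lemma horner_rprod d r x : (rprod d r).[x] = \prod_(0 <= j < d) (x - r j).
Proof. by rewrite horner_prod; apply: eq_bigr => j _; rewrite hornerXsubC. Qed.

Lemma size_rprod d r : size (rprod d r) = d.+1.
Proof. by rewrite size_prod_XsubC size_iota subn0. Qed.

Lemma lead_coef_rprod d r : (rprod d r)`_d = 1.
Proof.
have /monicP : rprod d r \is monic by exact: monic_prod_XsubC.
by rewrite lead_coefE size_rprod.
Qed.

Definition decr d r := forall i, (i.+1 < d)%N -> r i.+1 < r i.

Lemma decr_lt d r i j : decr d r -> (i < j < d)%N -> r j < r i.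
Proof.
move=> h /andP[]; elim: j => // j IH; rewrite ltnS leq_eqVlt => /predU1P[-> /h//|ij jd].
by apply: lt_trans (h _ jd) _; apply: IH => //; lia.
Qed.

(** In the product of the [r i - r j] over [j != i], exactly the [i] larger roots give negative
    factors. *)
Lemma deriv_rprod_sign d r i : decr d r -> (i < d)%N ->
  0 < (-1) ^+ i * (rprod d r)^`().[r i].
Proof.
move=> hr id.
have -> : (rprod d r)^`().[r i] =
    (\prod_(0 <= j < i) (r i - r j)) * \prod_(i.+1 <= j < d) (r i - r j).
  rewrite /rprod (@big_cat_nat _ _ _ i)//= ?(ltnW id)// [X in _ * X]big_ltn//.
  rewrite mulrCA derivM derivXsubC mul1r !hornerE subrr mul0r addr0.
  by rewrite !horner_prod; congr (_ * _); apply: eq_bigr => j _; rewrite hornerXsubC.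
rewrite mulrA; apply: mulr_gt0.
  rewrite -[in X in _ ^+ X](subn0 i); apply: sign_prod_neg => // j /andP[_ ji].
  by rewrite subr_lt0; apply: (decr_lt hr); lia.
by apply: prod_nat_gt0 => j ij; rewrite subr_gt0; apply: (decr_lt hr); lia.
Qed.

Lemma coef_affine_deriv (a b : R) (p : {poly R}) k :
  ((a%:P + b *: 'X) * p + 'X * (1 - 'X) * p^`())`_k.+1 =
  (a + k.+1%:R) * p`_k.+1 + (b - k%:R) * p`_k.
Proof.
have -> : (a%:P + b *: 'X) * p + 'X * (1 - 'X) * p^`() =
  a *: p + b *: ('X * p) + 'X * p^`() - 'X * ('X * p^`()).
  by rewrite -!mul_polyC; ring.
rewrite coefB !coefD !coefZ !coefXM !coef_deriv /=.
case: k => [|k] /=; first by rewrite mulr1n; ring.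
rewrite -(mulr_natr p`_k.+2) -(mulr_natr p`_k.+1); ring.
Qed.

(* [q] changes sign between consecutive points of the list made of [0], the
   roots of [p] and a point far to the left. *)
Lemma interlacing (c a b : R) d r : 0 < c -> 0 < a -> d%:R < b -> decr d r ->
  (forall j, (j < d)%N -> r j < 0) ->
  let p := c *: rprod d r in
  let q := (a%:P + b *: 'X) * p + 'X * (1 - 'X) * p^`() in
  exists r', [/\ decr d.+1 r', forall j, (j < d.+1)%N -> r' j < 0,
    forall j, (j < d)%N -> r' j.+1 < r j < r' j &
    q = (c * (b - d%:R)) *: rprod d.+1 r'].
Proof.
move=> c0 a0 db dr nr p q.
have lc0 : 0 < c * (b - d%:R) by apply: mulr_gt0 => //; rewrite subr_gt0.
have qE k : q`_k.+1 = (a + k.+1%:R) * p`_k.+1 + (b - k%:R) * p`_k by exact: coef_affine_deriv.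
have sp : size p = d.+1 by rewrite size_scale ?gt_eqF// size_rprod.
have pd : p`_d = c by rewrite coefZ lead_coef_rprod mulr1.
have qd : q`_d.+1 = c * (b - d%:R).
  by rewrite qE pd [p`_d.+1]nth_default ?sp//; ring.
have sq : size q = d.+2.
  apply/eqP; rewrite eqn_leq; apply/andP; split.
    apply/leq_sizeP => -[//|j] hj; rewrite qE !nth_default ?sp//; first ring.
    by lia.
  by rewrite ltnNge; apply/negP => /leq_sizeP/(_ _ (leqnn _)); rewrite qd => /eqP; rewrite gt_eqF.
have lq : lead_coef q = c * (b - d%:R) by rewrite lead_coefE sq.
pose pt0 i := if i is j.+1 then r j else 0.
(* The substitution x -> -x together with the sign (-1)^(d+1) turns the behaviour of [q] at minus
   infinity into a positive leading coefficient, which is where [d < b] is used. *)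
have [M Mlt Msg] : exists2 M, M < pt0 d & 0 < (-1) ^+ d.+1 * q.[M].
  pose s := (-1) ^+ d.+1 *: (q \Po - 'X).
  have ls : lead_coef s = c * (b - d%:R).
    rewrite lead_coefZ lead_coef_comp ?size_polyN ?size_polyX//.
    by rewrite lead_coefN lead_coefX sq lq mulrCA -exprD addnn -mul2n exprM sqrrN !expr1n mulr1.
  have [n hn] : exists n : R, forall x, x >= n -> s.[x] >= lead_coef s.
    by apply: poly_pinfty_gt_lc; rewrite ls.
  exists (- Num.max n (1 + `|pt0 d|)).
    rewrite ltrNl; apply: (@lt_le_trans _ _ (1 + `|pt0 d|)); last by rewrite le_max lexx orbT.
    by have := ler_norm (- pt0 d); rewrite normrN; lra.
  have := hn (Num.max n (1 + `|pt0 d|)); rewrite le_max lexx => /(_ isT).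
  by rewrite ls hornerZ horner_comp !hornerE; apply: lt_le_trans.
pose pt i := if i == d.+1 then M else pt0 i.
have ptS i : (i < d)%N -> pt i.+1 = r i by move=> id; rewrite /pt eqSS ltn_eqF.
have ptdec i : (i <= d)%N -> pt i.+1 < pt i.
  rewrite leq_eqVlt => /predU1P[->|id].
    by rewrite /pt eqxx ltn_eqF.
  rewrite ptS//; case: i id => [|i] id; first by rewrite /pt /=; exact: nr.
  by rewrite ptS; [exact: dr|lia].
have qx x : q.[x] = (a + b * x) * p.[x] + x * (1 - x) * p^`().[x].
  by rewrite /q; move: (p^`()) (p) => p1 p2; rewrite !hornerE.
have ptsg i : (i <= d.+1)%N -> 0 < (-1) ^+ i * q.[pt i].
  rewrite leq_eqVlt => /predU1P[->|]; first by rewrite /pt eqxx.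
  case: i => [_|i id].
    rewrite /pt /= expr0 mul1r qx mulr0 addr0 !mul0r addr0 hornerZ.
    rewrite horner_rprod; do 2![apply: mulr_gt0 => //].
    by apply: prod_nat_gt0 => j hj; rewrite sub0r oppr_gt0 nr.
  have {}id : (i < d)%N by [].
  rewrite ptS//; have ri := nr i id.
  have pz : p.[r i] = 0.
    rewrite hornerZ horner_rprod (@big_cat_nat _ _ _ i)//= ?(ltnW id)//.
    by rewrite [X in _ * (_ * X)]big_ltn// subrr mul0r !mulr0.
  (* At a root of [p] only x (1 - x) p'(x) survives. Here x (1 - x) < 0 since the root is negative,
     so [q] has the sign opposite to that of p', which is (-1)^i. *)
  rewrite qx pz mulr0 add0r derivZ hornerZ exprS.
  have := deriv_rprod_sign dr id; set D := _.[r i] => hD.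
  have -> : -1 * (-1) ^+ i * (r i * (1 - r i) * (c * D))
    = (- r i) * (1 - r i) * c * ((-1) ^+ i * D) by ring.
  apply: mulr_gt0 => //; apply: mulr_gt0 => //; apply: mulr_gt0; lra.
have ex i : exists x, (i <= d)%N -> pt i.+1 < x < pt i /\ root q x.
  have [id|] := boolP (i <= d)%N; last by exists 0.
  have [||x] := @poly_ivtoo _ q (pt i.+1) (pt i); first exact/ltW/ptdec.
    have h1 := ptsg i (leqW id); have h2 := ptsg i.+1 id.
    have e : (-1) ^+ i * (-1) ^+ i = 1 :> R by rewrite -expr2 sqrr_sign.
    have := mulr_gt0 h1 h2; rewrite exprS; move: e.
    set t := (-1) ^+ i; set u := q.[_]; set v := q.[_] => e.
    rewrite (_ : t * u * _ = - (t * t * (v * u))); last by ring.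
    by rewrite e mul1r oppr_gt0.
  by rewrite in_itv/= => hx rx; exists x.
have [r' hr'] := choice ex.
have dr' : decr d.+1 r'.
  move=> i id; have [/andP[_ h1] _] := hr' i.+1 id.
  by have [/andP[h2 _] _] := hr' i (ltnW id); exact: lt_trans h1 h2.
exists r'; split => //.
- move=> j; case: (posnP j) => [-> _|j0 jd].
    by have [/andP[_]] := hr' 0%N (leq0n d); rewrite /pt.
  apply: (@lt_trans _ _ (r' 0%N)); first by apply: (decr_lt dr'); rewrite j0.
  by have [/andP[_]] := hr' 0%N (leq0n d); rewrite /pt.
- move=> j jd; rewrite -(ptS _ jd).
  by have [/andP[_ ->] _] := hr' j.+1 jd; have [/andP[-> _] _] := hr' j (ltnW jd).
have := @all_roots_prod_XsubC _ q [seq r' i | i <- iota 0 d.+1].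
rewrite size_map size_iota sq lq big_map /rprod /index_iota subn0; apply => //.
  by apply/allP => _ /mapP[i + ->]; rewrite mem_iota => hi; have [] := hr' i hi.
rewrite uniq_rootsE map_inj_in_uniq ?iota_uniq// => i j.
rewrite !mem_iota !add0n => hi hj eij; apply/eqP/contraT.
rewrite neq_ltn => /orP[] h.
  by have := decr_lt dr' (_ : (i < j < d.+1)%N); rewrite eij ltxx; apply; rewrite h.
by have := decr_lt dr' (_ : (j < i < d.+1)%N); rewrite eij ltxx; apply; rewrite h.
Qed.

End Interlacing.

(** * Roots of the Euler-Frobenius polynomials *)

Section EulerFrobenius.
Variable R : realType.
Implicit Types (x : R) (r : nat -> R) (k m d : nat).
Notation Q := (@Q R).

Definition Epol m x : {poly R} := \poly_(j < m) Q m (x + j%:R).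

Lemma coef_Epol m x k : 0 <= x -> (Epol m.+1 x)`_k = Q m.+1 (x + k%:R).
Proof.
move=> x0; rewrite coef_poly; case: ltnP => // mk; rewrite Q_ge//.
by have : m.+1%:R <= k%:R :> R; [rewrite ler_nat|lra].
Qed.

Lemma horner_Epol m x : (Epol m x).[-1] = gsum m x.
Proof. by rewrite horner_poly; apply: eq_bigr => j _; rewrite mulrC. Qed.

(** This is [Q_rec] read coefficientwise; its weights are affine in the index, which produces the
    derivative term. The condition on [x] makes [Q m.+1 (x - 1)] vanish in the constant coefficient.
    The value [x = 1] is included for the case [alpha = 0] of even order. *)
Lemma Epol_rec m x : 0 < x -> (x < 1) || (0 < m)%N && (x <= 1) ->
  m.+1%:R *: Epol m.+2 x = (x%:P + (m.+1%:R - x) *: 'X) * Epol m.+1 x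
     + 'X * (1 - 'X) * (Epol m.+1 x)^`().
Proof.
move=> x0 x1; apply/polyP => -[|k]; rewrite coefZ coef_Epol ?(ltW x0)//; last first.
  rewrite coef_affine_deriv !coef_Epol ?(ltW x0)// Q_rec.
  have -> : x + k.+1%:R - 1 = x + k%:R by rewrite -natr1; ring.
  by rewrite -!natr1; ring.
rewrite addr0 Q_rec -[RHS]horner_coef0.
have -> : Q m.+1 (x - 1) = 0.
  case/orP: x1 => [x1|/andP[m0 x1]]; first by rewrite Q_lt0// subr_lt0.
  by case: m m0 => // m _; rewrite Q_le0// subr_le0.
move: (_^`()) (coef_Epol m 0 (ltW x0)) => q; rewrite -horner_coef0 addr0 => <-.
by rewrite !hornerE.
Qed.

(* [k] is the number of roots in the unit disc. *)
Definition rfact m x k := exists c d r, [/\ 0 < c, d%:R < m%:R - x, decr d r,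
  forall j, (j < d)%N -> r j < 0 & [/\ Epol m x = c *: rprod d r, (k <= d)%N &
  forall j, (j < d)%N -> (-1 < r j) = (j < k)%N]].

(** By interlacing the new roots before index [k] lie above old roots in (-1, 0), and those after
    index [k] lie below old roots that are at most -1. Only [r' k] is undecided, and [b] records on
    which side it falls. *)
Lemma rfact_step m x k : 0 < x -> (x < 1) || (0 < m)%N && (x <= 1) ->
  rfact m.+1 x k -> exists b : bool, rfact m.+2 x (k + b).
Proof.
move=> x0 x1 [c [d [r [c0 dm dr nr [eE kd hk]]]]].
have [r' [dr' nr' int eq]] := interlacing c0 x0 dm dr nr.
exists (-1 < r' k); exists ((c * (m.+1%:R - x - d%:R)) / m.+1%:R), d.+1, r'.
split => //.
- by rewrite divr_gt0// mulr_gt0// subr_gt0.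
- by rewrite -!(natr1 _) in dm *; lra.
split.
- apply: (@scalerI _ _ (m.+1%:R : R)); first by rewrite pnatr_eq0.
  by rewrite Epol_rec// eE eq scalerA mulrCA divff ?mulr1// pnatr_eq0.
- by case: (_ < _); lia.
move=> j jd; have [jk|jk|->] := ltngtP j k.
- have jd' : (j < d)%N by lia.
  have /andP[_ h] := int j jd'.
  rewrite (_ : (j < _)%N = true); last lia.
  by apply: lt_trans h; rewrite hk.
- case: j jd jk => // j jd jk.
  have jd' : (j < d)%N by lia.
  have /andP[h _] := int j jd'.
  rewrite (_ : (j.+1 < _)%N = false); last by case: (_ < r' k); lia.
  apply/negbTE; rewrite -leNgt; apply/ltW/(lt_le_trans h).
  by rewrite leNgt hk// -leqNgt -ltnS.
by case: (_ < _); lia.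
Qed.

(** At -1 each of the [k] roots in the disc contributes a negative factor, and the others a
    nonnegative one. *)
Lemma rfact_sign m x k : rfact m x k -> gsum m x != 0 -> 0 < (-1) ^+ k * gsum m x.
Proof.
move=> [c [d [r [c0 dm dr nr [eE kd hk]]]]] g0; rewrite lt_def mulf_neq0 ?signr_eq0//=.
rewrite -horner_Epol eE hornerZ horner_rprod mulrCA mulr_ge0 ?(ltW c0)//.
rewrite (@big_cat_nat _ _ _ k)//= mulrA mulr_ge0//.
  rewrite ltW// -[in X in X ^+ _ * _]/(-1) -{1}(subn0 k); apply: sign_prod_neg => // j jk.
  have := hk j; rewrite (_ : (j < k)%N) => [h|]; last by lia.
  by have := h ltac:(lia); lra.
rewrite big_seq prodr_ge0// => j; rewrite mem_index_iota => /andP[kj jd].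
by have := hk j jd; rewrite ltnNge kj /= => /negbT; rewrite -leNgt; lra.
Qed.

Lemma parity_of_sign k h (g : R) : 0 < (-1) ^+ k * g -> 0 < (-1) ^+ h * g ->
  odd k = odd h.
Proof.
rewrite -(signr_odd _ k) -(signr_odd _ h).
by case: (odd k) (odd h) => [] [] //; rewrite ?expr0 ?expr1 ?mul1r ?mulN1r; lra.
Qed.

(** Two steps add 0, 1 or 2 roots to the disc; the sign at -1 fixes the parity of the count and
    excludes 0 and 2. *)
Lemma rfact_step2 m x k : 0 < x -> (x < 1) || (0 < m)%N && (x <= 1) ->
  rfact m.+1 x k -> 0 < (-1) ^+ k.+1 * gsum m.+3 x -> rfact m.+3 x k.+1.
Proof.
move=> x0 x1 /(rfact_step x0 x1)[b].
have x1' : (x < 1) || (0 < m.+1)%N && (x <= 1).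
  by case/orP: x1 => [->//|/andP[_ ->]]; rewrite orbT.
move=> /(rfact_step x0 x1')[b'] h s.
have g0 : gsum m.+3 x != 0 by apply: contraTneq s => ->; rewrite mulr0 ltxx.
have := parity_of_sign (rfact_sign h g0) s.
by case: b b' h => [] [] h; rewrite ?addn0 ?addn1 in h *; rewrite /= ?negbK => // /eqP;
  rewrite ?eqbF_neg; case: (odd k).
Qed.

Lemma rfact1 x : 0 < x < 1 -> rfact 1 x 0.
Proof.
move=> /andP[x0 x1]; exists 1, 0%N, (fun=> 0); split => //; first lra.
split => //; rewrite scale1r /rprod big_geq//; apply/polyP => k.
rewrite coef_Epol ?(ltW x0)// coef1; case: k => [|k].
  by rewrite addr0 /Q /= /chi01 (ltW x0) x1.
by rewrite Q_ge// -natr1; have := ler0n R k; lra.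
Qed.

Lemma rfact_odd p x : 0 < x < 1 -> rfact p.*2.+1 x p.
Proof.
move=> /[dup] x01 /andP[x0 x1]; elim: p => [|p IH]; first exact: rfact1.
apply: rfact_step2 => //; first by rewrite x1.
by have [_ h] := sign_gsum R p; exact: h.
Qed.

Lemma rfact_even_left p x : 0 < x < 1 / 2 -> rfact p.*2.+2 x p.+1.
Proof.
move=> /andP[x0 x1]; have xlt1 : x < 1 by lra.
have sg q : 0 < (-1) ^+ q.+1 * gsum q.*2.+2 x.
  by have [h _] := sign_gsum R q; apply: h; lra.
elim: p => [|p IH]; last by apply: rfact_step2 (sg p.+1) => //; rewrite xlt1.
have h1 : rfact 1 x 0 by apply: rfact1; rewrite x0.
have [|b h] := rfact_step x0 _ h1; first by rewrite xlt1.
have g0 : gsum 2 x != 0.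
  by have := sg 0%N; apply: contraTneq => ->; rewrite mulr0 ltxx.
by have := parity_of_sign (rfact_sign h g0) (sg 0%N); case: b h.
Qed.

Lemma rfact_even_right p x : 1 / 2 < x <= 1 -> rfact p.*2.+2 x p.
Proof.
move=> /andP[x0 x1]; have xgt0 : 0 < x by lra.
have sg q : 0 < (-1) ^+ q * gsum q.*2.+2 x by apply: sign_gsum_right; lra.
elim: p => [|p IH]; last by apply: rfact_step2 (sg p.+1) => //; rewrite x1 orbT.
have g0 : gsum 2 x != 0.
  by have := sg 0%N; apply: contraTneq => ->; rewrite mulr0 ltxx.
(* At [x = 1] the symbol of order 1 is zero and cannot serve as a base; the symbol of order 2 is
   then the constant 1, with no roots. *)
move: x1; rewrite le_eqVlt => /predU1P[x1|x1].
  exists 1, 0%N, (fun=> 0); split => //; first by rewrite x1 -[0.*2.+2]/2%N; lra.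
  split => //; rewrite scale1r /rprod big_geq//; apply/polyP => k.
  rewrite coef_Epol ?(ltW xgt0)// coef1 x1; case: k => [|k].
    by rewrite addr0 -[0.*2.+2]/2%N Q2_left ?lexx ?ler01.
  by rewrite -[0.*2.+2]/2%N Q_ge// -(natr1 k); have := ler0n R k; lra.
have h1 : rfact 1 x 0 by apply: rfact1; rewrite xgt0.
have [|b h] := rfact_step xgt0 _ h1; first by rewrite x1.
by have := parity_of_sign (rfact_sign h g0) (sg 0%N); case: b h.
Qed.

(** * Polynomials acting on sequences by convolution *)

Implicit Types (c : int -> R) (n : int) (p : {poly R}).

Definition act p c n : R := \sum_(j < size p) p`_j * c (n - j%:Z).

Lemma act_widen p c n (N : nat) : (size p <= N)%N ->
  act p c n = \sum_(j < N) p`_j * c (n - j%:Z).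
Proof.
move=> sN; rewrite /act (big_ord_widen N (fun j => p`_j * c (n - j%:Z)))//.
rewrite [RHS](bigID (fun j : 'I_N => (j < size p)%N))/= [X in _ = _ + X]big1 ?addr0//.
by move=> j; rewrite -leqNgt => h; rewrite nth_default// mul0r.
Qed.

Lemma act_poly (N : nat) (E : nat -> R) c n :
  act (\poly_(j < N) E j) c n = \sum_(j < N) E j * c (n - j%:Z).
Proof.
rewrite (act_widen _ _ (size_poly _ _)); apply: eq_bigr => j _.
by rewrite coef_poly ltn_ord.
Qed.

Lemma act_scale a p c n : act (a *: p) c n = a * act p c n.
Proof.
rewrite (@act_widen _ _ _ (size p)) ?size_scale_leq// mulr_sumr.
by apply: eq_bigr => j _; rewrite coefZ mulrA.
Qed.

Lemma act1 c n : act 1 c n = c n.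
Proof. by rewrite /act size_poly1 big_ord1 coef1 mul1r subr0. Qed.

Lemma act_XsubC (r : R) p c n :
  act (('X - r%:P) * p) c n = act p c (n - 1) - r * act p c n.
Proof.
rewrite (@act_widen _ _ _ (size p).+1); last first.
  by apply: (leq_trans (size_polyMleq _ _)); rewrite size_XsubC.
rewrite (@act_widen p c n (size p).+1)// mulr_sumr.
under eq_bigr do rewrite mulrBl coefB coefXM coefCM mulrBl.
rewrite sumrB big_ord_recl/= mul0r add0r; congr (_ - _); last first.
  by apply: eq_bigr => j _; rewrite mulrA.
apply: eq_bigr => j _; rewrite -[bump 0 j]/(j.+1); congr (_ * c _).
by rewrite -[j.+1]addn1 PoszD opprD addrA addrAC.
Qed.

(** Since [z] acts as c(n) -> c(n - 1), the factor [z - r] is an upper triangular factor read one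
    index to the left. Every root treated in this way, meant for roots in the disc, costs one unit
    of shift. *)
Lemma act_inside (s : seq nat) (r : nat -> R) p c n :
  act (\prod_(j <- s) ('X - (r j)%:P) * p) c n =
  Ops 1 [seq r j | j <- s] (act p c) (n - (size s)%:Z).
Proof.
elim: s n => [|j s IH] n; first by rewrite big_nil mul1r subr0.
rewrite big_cons -mulrA act_XsubC !IH /= /Op.
have -> : n - 1 - (size s)%:Z = n - (size s).+1%:Z by rewrite -[(size s).+1]addn1 PoszD; lia.
by have -> : n - (size s).+1%:Z + 1 = n - (size s)%:Z by rewrite -[(size s).+1]addn1 PoszD; lia.
Qed.

(** Pulling out [- r] leaves the lower triangular factor with parameter [1/r] and no shift; this is
    the form for roots outside the disc. *)
Lemma act_outside (s : seq nat) (r : nat -> R) p c n :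
  (forall j, j \in s -> r j != 0) ->
  act (\prod_(j <- s) ('X - (r j)%:P) * p) c n =
  (\prod_(j <- s) - r j) * Ops (-1) [seq (r j)^-1 | j <- s] (act p c) n.
Proof.
elim: s n => [|j s IH] n h; first by rewrite !big_nil !mul1r.
rewrite !big_cons -mulrA act_XsubC !IH; try by move=> i hi; apply: h; rewrite inE hi orbT.
have r0 : r j != 0 by apply: h; rewrite inE eqxx.
by rewrite /= /Op; field.
Qed.

(** The Wiener-Hopf factorization of the symbol; the shift by [k], the number of roots in the disc,
    carries its index. As the symbol does not vanish at -1, the remaining roots are strictly below
    -1 and their inverses are contractive. *)
Lemma rfact_act m x k : rfact m x k -> gsum m x != 0 ->
  exists a u l, [/\ a != 0, contr u, contr l &
    forall c n, act (Epol m x) c n = a * Ops 1 u (Ops (-1) l c) (n - k%:Z)].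
Proof.
move=> [c0 [d [r [c00 dm dr nr [eE kd hk]]]]] g0.
have outlt j : (k <= j < d)%N -> r j < -1.
  move=> /andP[kj jd]; have := hk j jd; rewrite ltnNge kj /= => /negbT; rewrite -leNgt.
  rewrite le_eqVlt => /predU1P[rj|//]; move: g0.
  rewrite -horner_Epol eE hornerZ horner_rprod (@big_cat_nat _ _ _ j)//=; last exact: ltnW.
  by rewrite [X in _ * (_ * X)]big_ltn// rj subrr mul0r !mulr0 eqxx.
exists (c0 * \prod_(j <- iota k (d - k)) - r j), [seq r j | j <- iota 0 k],
  [seq (r j)^-1 | j <- iota k (d - k)]; split.
- apply: mulf_neq0; [by rewrite gt_eqF|rewrite prodf_seq_neq0].
  by apply/allP => j; rewrite mem_iota => hj /=; rewrite oppr_eq0 lt_eqF// nr//; lia.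
- apply/allP => _ /mapP[j + ->]; rewrite mem_iota => hj.
  rewrite ltr_norml hk; last lia.
  by rewrite (_ : (j < k)%N) ?(lt_trans (nr j _))//; lia.
- apply/allP => _ /mapP[j + ->]; rewrite mem_iota => hj.
  have h := outlt j ltac:(lia).
  rewrite normfV invf_lt1 ?ltr0_norm; lra.
move=> c n; rewrite eE act_scale.
have -> : rprod d r = \prod_(j <- iota 0 k) ('X - (r j)%:P) *
   (\prod_(j <- iota k (d - k)) ('X - (r j)%:P) * 1).
  by rewrite mulr1 -big_cat -iotaD /rprod /index_iota subnKC ?subn0.
rewrite act_inside size_iota -mulrA; congr (_ * _).
have -> : act (\prod_(j <- iota k (d - k)) ('X - (r j)%:P) * 1) c =
   fun n => (\prod_(j <- iota k (d - k)) - r j) *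
      Ops (-1) [seq (r j)^-1 | j <- iota k (d - k)] c n.
  apply/funext => i; rewrite act_outside.
    by congr (_ * Ops _ _ _ _); apply/funext => q; rewrite act1.
  by move=> j; rewrite mem_iota => hj; rewrite lt_eqF// nr//; lia.
by rewrite OpsZ.
Qed.

End EulerFrobenius.

(** * Spline series and their samples *)

Section SplineSeries.
Variable R : realType.
Implicit Types (x y : R) (c g : int -> R) (n k : int).
Notation Q := (@Q R).

Definition symsum g (N : nat) : R := \sum_(i < N) (g i%:Z + g (- (i.+1)%:Z)).

Lemma symsum_delta (k0 : int) (a : R) (N : nat) : (`|k0| < N)%N ->
  symsum (fun k => if k == k0 then a else 0) N = a.
Proof.
rewrite /symsum big_split/=; case: k0 => p pN.
  rewrite [X in _ + X]big1 ?addr0 => [|i _].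
    by rewrite -big_mkcond /= (big_pred1 (Ordinal pN))// => i; rewrite -val_eqE.
  by [].
rewrite [X in X + _]big1 ?add0r => [|i _]; last by [].
have pN' : (p < N)%N by lia.
by rewrite -big_mkcond /= (big_pred1 (Ordinal pN'))// => i; rewrite -val_eqE /=.
Qed.

Lemma symsum_finite (M : nat) n g (N : nat) :
  (forall k, (forall j : 'I_M, k != n - j%:Z) -> g k = 0) ->
  (`|n| + M < N)%N -> symsum g N = \sum_(j < M) g (n - j%:Z).
Proof.
move=> hg hN.
have -> : g = fun k => \sum_(j < M) (if k == n - j%:Z then g (n - j%:Z) else 0).
  apply/funext => k; have [/existsP[j /eqP kj]|] := boolP [exists j : 'I_M, k == n - j%:Z].
    rewrite (bigD1 j)//= kj eqxx big1 ?addr0// => i ij; rewrite ifF//.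
    by apply: contraNF ij => /eqP e; apply/eqP/val_inj => /=; lia.
  rewrite negb_exists => /forallP h; rewrite hg// big1// => j _.
  by rewrite ifF//; apply/negbTE.
rewrite /symsum; under eq_bigr do rewrite -big_split/=.
rewrite exchange_big/=; apply: eq_bigr => j _.
have := @symsum_delta (n - j%:Z) (g (n - j%:Z)) N ltac:(have := ltn_ord j; lia).
rewrite /symsum => ->; rewrite (bigD1 j)//= eqxx big1 ?addr0// => i ij; rewrite ifF//.
by apply: contraNF ij => /eqP e; apply/eqP/val_inj => /=; lia.
Qed.

Variable m : nat.
Local Notation M := m.+2.

Lemma act_Epol y c n : act (Epol M y) c n = \sum_(j < M) Q M (y + j%:R) * c (n - j%:Z).
Proof. exact: act_poly. Qed.

(** The partial sums are eventually constant. Both end points of [0, 1] are allowed because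
    B-splines of order at least 2 vanish at both ends of their support. *)
Lemma psum_cvg y n c : 0 <= y <= 1 ->
  psum (Q M) c (y + n%:~R) N @[N --> \oo] --> act (Epol M y) c n.
Proof.
move=> /andP[y0 y1]; apply: cvg_near_cst; near=> N.
rewrite act_Epol.
rewrite -[LHS]/(symsum (fun k => c k * Q M (y + n%:~R - k%:~R)) N).
rewrite (@symsum_finite M n); first last.
- by near: N; exact: nbhs_infty_gt.
- move=> k hk; have [kn|kn] := ltP n k.
    have h : n%:~R + 1 <= k%:~R :> R by rewrite -intrD1 ler_int; lia.
    by rewrite Q_le0 ?mulr0//; lra.
  have [kM|kM] := leP (M%:Z) (n - k).
    have h : (M%:R : R) <= n%:~R - k%:~R by rewrite -intrB pmulrn ler_int.
    by rewrite Q_ge ?mulr0//; lra.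
  have hj : (`|n - k| < M)%N by lia.
  by have := hk (Ordinal hj); rewrite /= => /eqP; lia.
apply: eq_bigr => j _; rewrite mulrC; congr (Q M _ * _).
by rewrite intrB opprB addrA -pmulrn; ring.
Unshelve. all: by end_near.
Qed.

Definition spl c x : R := act (Epol M (fracpart x)) c (Num.floor x).

Lemma fracpart_itv x : 0 <= fracpart x < 1.
Proof. by rewrite /fracpart subr_ge0 ltrBlDl -intrD1 floor_le_tmp floorD1_gt. Qed.

Lemma psum_spl c x : psum (Q M) c x N @[N --> \oo] --> spl c x.
Proof.
have /andP[h0 h1] := fracpart_itv x.
rewrite {1}(_ : x = fracpart x + (Num.floor x)%:~R); last by rewrite /fracpart subrK.
by apply: psum_cvg; rewrite h0 ltW.
Qed.

Lemma spl_add y n c : 0 <= y <= 1 -> spl c (y + n%:~R) = act (Epol M y) c n.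
Proof. by move=> h; have := cvg_unique _ (@psum_spl c (y + n%:~R)) (@psum_cvg y n c h); exact. Qed.

Lemma spl_shift x n c : spl c (x + n%:~R) = act (Epol M (fracpart x)) c (Num.floor x + n).
Proof.
have /andP[h0 h1] := fracpart_itv x.
rewrite {1}(_ : x = fracpart x + (Num.floor x)%:~R); last by rewrite /fracpart subrK.
by rewrite -addrA -intrD spl_add// h0 ltW.
Qed.

Lemma inV_spl (f : R -> R) : inV (Q M) f <-> exists2 c, l2 c & forall x, f x = spl c x.
Proof.
split=> [[c [lc h]]|[c lc h]]; exists c => //.
  by move=> x; have := cvg_unique _ (h x) (@psum_spl c x); exact.
by split => // x; rewrite h; exact: psum_spl.
Qed.

Lemma fracpart_half (N : nat) : fracpart (N%:R / 2 : R) = (odd N)%:R / 2.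
Proof.
rewrite /fracpart (_ : Num.floor _ = (N./2)%:Z).
  by rewrite -{1}(odd_double_half N) natrD -mul2n natrM pmulrn; field.
apply: floor_def; rewrite intrD1 -!pmulrn -{2 3}(odd_double_half N) natrD -mul2n natrM.
by case: (odd N) => /=; lra.
Qed.

Notation th := (fracpart (M%:R / 2 : R)).

Lemma LambdaE (alpha : R) n :
  Lambda M alpha n = (if 0 <= n then th else alpha + th) + n%:~R.
Proof. by rewrite /Lambda; case: ifP. Qed.

(** The shift [M./2] is the same for every admissible [alpha], hence for both halves of the paired
    operator: this is the vanishing of the index. It is the number of roots in the disc for odd
    order, and for even order with [alpha > 0]. *)
Lemma sample_factor (alpha : R) : `|alpha| < 1 / 2 ->
  exists a u l, [/\ a != 0, contr u, contr l & forall c n,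
    spl c (alpha + th + n%:~R) = a * Ops 1 u (Ops (-1) l c) (n - (M./2)%:Z)].
Proof.
rewrite ltr_norml => /andP[a1 a2]; rewrite fracpart_half.
have ne0 (k : nat) (v : R) : 0 < (-1) ^+ k * v -> v != 0.
  by apply: contraTneq => ->; rewrite mulr0 ltxx.
have [oM|eM] := boolP (odd M).
  have [p eM] : exists p, M = p.*2.+3 by exists m./2; lia.
  have h : 0 < alpha + 1 / 2 < 1 by lra.
  have [_ /(_ _ h)/ne0 sg] := sign_gsum R p.
  have := rfact_odd p.+1 h; rewrite doubleS -eM => /rfact_act.
  rewrite eM => /(_ sg)[a [u [l [a0 cu cl e]]]]; exists a, u, l; split => // c n.
  rewrite -eM in e *; rewrite spl_add; last by rewrite -[true%:R]/(1%R : R); lra.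
  by rewrite e; congr (_ * Ops _ _ _ (_ - _)); lia.
have [p eM'] : exists p, M = p.*2.+2 by exists m./2; lia.
rewrite mul0r addr0; have [al|al] := ltP 0 alpha.
  have h : 0 < alpha < 1 / 2 by lra.
  have sg : gsum p.*2.+2 alpha != 0.
    by have [hs _] := sign_gsum R p; apply/(@ne0 p.+1)/hs; lra.
  have := rfact_even_left p h; rewrite -eM' => /rfact_act.
  rewrite eM' => /(_ sg)[a [u [l [a0 cu cl e]]]]; exists a, u, l; split => // c n.
  rewrite -eM' in e *; rewrite spl_add; last by lra.
  by rewrite e; congr (_ * Ops _ _ _ (_ - _)); lia.
have h : 1 / 2 < alpha + 1 <= 1 by lra.
have sg : gsum p.*2.+2 (alpha + 1) != 0.
  by apply/(@ne0 p)/sign_gsum_right.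
have := rfact_even_right p h; rewrite -eM' => /rfact_act.
rewrite eM' => /(_ sg)[a [u [l [a0 cu cl e]]]]; exists a, u, l; split => // c n.
(* For even order and [alpha <= 0] the offset becomes [alpha + 1]: there is one root fewer in the
   disc, and the index [n - 1] makes up for it. *)
rewrite -eM' in e *; rewrite (_ : alpha + n%:~R = alpha + 1 + (n - 1)%:~R); last first.
  by rewrite intrB; ring.
rewrite spl_add; last by lra.
by rewrite e; congr (_ * Ops _ _ _ _); lia.
Qed.

End SplineSeries.

(** * The sampling operator on coefficient sequences *)

Section Sampling.
Variables (R : realType) (m : nat).
Implicit Types (x y alpha : R) (c : int -> R) (n k : int).
Local Notation M := m.+2.
Local Notation Q := (@Q R).

Definition samples alpha c : int -> R := fun n => spl m c (Lambda M alpha n).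

Lemma sqn_act (p : {poly R}) : exists2 K : R, 0 < K & forall c,
  (sqn (act p c) <= K%:E * sqn c)%E.
Proof.
rewrite /act; elim: (size p) => [|N [K K0 IH]].
  exists 1 => // c; rewrite sqn0 ?mul1e ?sqn_ge0// => n; exact: big_ord0.
exists (2 * K + 2 * p`_N ^+ 2); first by have := sqr_ge0 p`_N; lra.
move=> c; pose b n := \sum_(j < N) p`_j * c (n - j%:Z).
apply: (@le_trans _ _ (2%:E * (K%:E * sqn c) + (2 * p`_N ^+ 2)%:E * sqn c)%E).
  apply: (@le_trans _ _ (2%:E * sqn b + (2 * p`_N ^+ 2)%:E * sqn c)%E); last first.
    by apply: leeD => //; apply: lee_wpmul2l => //; exact: IH.
  rewrite -[X in (_ <= _ + _ * X)%E](sqn_shift c (- N%:Z)); apply: sqn_comb => //.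
    by rewrite mulr_ge0// sqr_ge0.
  move=> n; rewrite big_ord_recr/= -/(b n); set u := b n; set v := c _.
  by have := sqr_ge0 (u - p`_N * v); nra.
have k0 : 0 <= 2 * K by lra.
have q0 : 0 <= 2 * p`_N ^+ 2 by rewrite mulr_ge0// sqr_ge0.
by rewrite muleA -EFinM -ge0_muleDl ?lee_fin// -EFinD.
Qed.

Lemma sqn_samples_le alpha : exists2 K : R, 0 < K & forall c,
  (sqn (samples alpha c) <= K%:E * sqn c)%E.
Proof.
pose t := fracpart (M%:R / 2 : R); pose s := alpha + t.
have [K1 K10 h1] := sqn_act (Epol M (fracpart t)).
have [K2 K20 h2] := sqn_act (Epol M (fracpart s)).
exists (2 * (K1 + K2)); first lra.
move=> c; have -> : samples alpha c = fun n => if 0 <= n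
   then act (Epol M (fracpart t)) c (n + Num.floor t)
   else act (Epol M (fracpart s)) c (n + Num.floor s).
  by apply/funext => n; rewrite /samples LambdaE spl_shift; case: ifP => _; congr (act _ c _); rewrite addrC.
apply: sqn_glue; first lra.
  rewrite (sqn_shift (act _ c)); apply: (le_trans (h1 c)); apply: lee_wpmul2r.
    exact: sqn_ge0.
  by rewrite lee_fin; lra.
rewrite (sqn_shift (act _ c)); apply: (le_trans (h2 c)); apply: lee_wpmul2r.
  exact: sqn_ge0.
by rewrite lee_fin; lra.
Qed.

Lemma samples_paired alpha : `|alpha| < 1 / 2 ->
  exists w uA lA uB lB, [/\ (exists2 K : R, 0 < K & forall n : int, w n ^- 2 <= K),
    [/\ (forall n, w n != 0), contr uA, contr lA, contr uB & contr lB] & forall c,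
    samples alpha c = fun n => w n * paired uA lA uB lB (fun n => c (n - (M./2)%:Z)) n].
Proof.
move=> ha.
have [a [uA [lA [a0 cuA clA eA]]]] := @sample_factor R m 0 ltac:(rewrite normr0; lra).
have [b [uB [lB [b0 cuB clB eB]]]] := @sample_factor R m alpha ha.
(* The weight collects the scalar factors of the two symbols; the nonnegative rows are the case
   [alpha = 0]. *)
exists (fun n => if 0 <= n then a else b), uA, lA, uB, lB; split.
- exists (a ^- 2 + b ^- 2).
    by rewrite ltr_pwDl ?invr_ge0 ?sqr_ge0// invr_gt0 exprn_even_gt0.
  by move=> n; case: ifP => _; rewrite ?lerDl ?lerDr ?invr_ge0 ?sqr_ge0.
- by split => // n; case: ifP.
move=> c; apply/funext => n; rewrite /samples LambdaE /paired !Ops_shift.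
case: ifP => n0; last by rewrite eB.
by rewrite -[fracpart _]add0r eA.
Qed.

Lemma samples_stable alpha : `|alpha| < 1 / 2 -> exists2 K : R, 0 < K &
  forall c, l2 c -> (sqn c <= K%:E * sqn (samples alpha c))%E.
Proof.
move=> /samples_paired[w [uA [lA [uB [lB [[W W0 hW] [w0 cuA clA cuB clB] e]]]]]].
have [K K0 hK] := paired_stable cuA clA cuB clB.
have [Ks Ks0 hKs] := sqn_samples_le alpha.
exists (K * W); first exact: mulr_gt0.
move=> c lc; pose c' n := c (n - (M./2)%:Z).
have bp : (sqn (paired uA lA uB lB c') <= W%:E * sqn (samples alpha c))%E.
  apply: sqn_dom; first exact: ltW.
  move=> n; rewrite e -/c' exprMn mulrA -[X in X <= _]mul1r.
  apply: ler_wpM2r; first exact: sqr_ge0.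
  rewrite -(@mulVf _ (w n ^+ 2)) ?expf_neq0//.
  by apply: ler_wpM2r; [exact: sqr_ge0|exact: hW].
rewrite -(sqn_shift c (- (M./2)%:Z)) EFinM -muleA.
apply: (le_trans (hK _ (l2_shift _ lc) _)).
  by apply: sqn_le_l2 bp _; exact: sqn_le_l2 (hKs c) lc.
by apply: lee_wpmul2l => //; rewrite lee_fin ltW.
Qed.

Lemma samples_onto alpha : `|alpha| < 1 / 2 ->
  forall y : int -> R, l2 y -> exists2 c, l2 c & samples alpha c = y.
Proof.
move=> /samples_paired[w [uA [lA [uB [lB [[W W0 hW] [w0 cuA clA cuB clB] e]]]]]] y ly.
have [K K0 hK] := paired_surj cuA clA cuB clB.
have ly' : l2 (fun n => y n / w n).
  apply: (@sqn_le_l2 _ _ y W) ly; apply: sqn_dom; first exact: ltW.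
  by move=> n; rewrite exprMn mulrC exprVn; apply: ler_wpM2r; [exact: sqr_ge0|].
have [c [ec bc]] := hK _ ly'; exists (fun n => c (n + (M./2)%:Z)).
  exact/l2_shift/(sqn_le_l2 bc).
rewrite e; apply/funext => n.
rewrite (_ : (fun n => c (n - (M./2)%:Z + (M./2)%:Z)) = c); last by apply/funext => k; rewrite subrK.
by rewrite ec mulrCA divff// mulr1.
Qed.

End Sampling.

(** * Riesz bounds *)

Section Tiles.
Variable R : realType.
Implicit Types (g : R -> R) (n : int) (w v e : int -> R).
Notation mu := (@lebesgue_measure R).

Definition tile n : set R := `[n%:~R, n%:~R + 1[.

Lemma tileP n x : tile n x <-> Num.floor x = n.
Proof.
rewrite /tile /= in_itv /=; split => [h|<-].
  by apply: floor_def; rewrite intrD1.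
by rewrite -intrD1 floor_le_tmp floorD1_gt.
Qed.

Lemma L2sq_tiles g : measurable_fun setT g ->
  L2sq g = \esum_(n in [set: int]) (\int[mu]_(x in tile n) ((g x) ^+ 2)%:E)%E.
Proof.
move=> mg; rewrite esum_int; last first.
  by move=> n; apply: integral_ge0 => x _; rewrite lee_fin sqr_ge0.
rewrite /L2sq -[RHS]/(\sum_(i <oo) \int[mu]_(x in (tile \o int_enum) i) ((g x) ^+ 2)%:E)%E.
have eT : [set: R] = \bigcup_i (tile \o int_enum) i.
  apply/seteqP; split => // x _.
  have [_ _ /(_ (Num.floor x) I)[i _ ei]] := int_enum_bij.
  by exists i => //=; apply/tileP.
rewrite [in LHS]eT ge0_integral_bigcup//.
- by move=> i; exact: measurable_itv.
- rewrite -eT; apply/measurable_EFinP; exact: measurable_funX.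
- by move=> x _; rewrite lee_fin sqr_ge0.
apply/trivIsetP => i j _ _ ij; apply/seteqP; split => // x /= [/tileP hi /tileP hj].
have [_ inj _] := int_enum_bij.
by move/eqP: ij; apply; apply: inj; rewrite ?inE// -hi.
Qed.

Lemma measure_itv_co (a b : R) : a <= b -> mu (`[a, b[ : set R) = (b - a)%:E.
Proof.
move=> ab; rewrite lebesgue_measure_itv /= lte_fin; case: ltP => // ba.
by have -> : a = b; [apply/eqP; rewrite eq_le ab|rewrite subrr].
Qed.

Lemma integral_cst_co (a b r : R) : a <= b ->
  (\int[mu]_(x in `[a, b[) (cst r%:E) x = (r * (b - a))%:E)%E.
Proof.
move=> ab; rewrite integral_cst; last exact: measurable_itv.
by rewrite EFinM; congr (_ * _)%E; exact: measure_itv_co.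
Qed.

Lemma L2sq_tiles_le g w : measurable_fun setT g ->
  (forall n x, tile n x -> g x ^+ 2 <= w n ^+ 2) -> (L2sq g <= sqn w)%E.
Proof.
move=> mg h; rewrite L2sq_tiles//; apply: le_esum => n _.
have e : ((w n ^+ 2)%:E = \int[mu]_(x in tile n) (cst (w n ^+ 2)%:E) x)%E.
  by rewrite integral_cst_co ?lerDl// addrAC subrr add0r mulr1.
rewrite e; apply: ge0_le_integral.
- exact: measurable_itv.
- by move=> x _; rewrite lee_fin sqr_ge0.
- apply/measurable_EFinP/measurable_funX; exact: measurable_funTS.
- exact: measurable_cst.
- by move=> x nx; rewrite lee_fin; exact: h.
Qed.

Lemma L2sq_tiles_ge g v e (t d : R) : measurable_fun setT g ->
  0 <= t -> 0 < d -> t + d <= 1 ->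
  (forall n x, t + n%:~R <= x < t + n%:~R + d ->
    v n ^+ 2 <= 2 * g x ^+ 2 + 2 * e n ^+ 2) ->
  ((d / 2)%:E * sqn v <= L2sq g + d%:E * sqn e)%E.
Proof.
move=> mg t0 d0 td h; rewrite L2sq_tiles//.
have d20 : 0 <= d / 2 by lra.
have sq0 (u : int -> R) n : (0 <= (u n ^+ 2)%:E)%E by rewrite lee_fin sqr_ge0.
rewrite -(esum_intZ (sq0 v) d20) -(esum_intZ (sq0 e) (ltW d0)).
rewrite -esumD; first last.
- by move=> n _; rewrite -EFinM lee_fin mulr_ge0 ?sqr_ge0// ltW.
- by move=> n _; apply: integral_ge0 => x _; rewrite lee_fin sqr_ge0.
apply: le_esum => n _.
pose I : set R := `[t + n%:~R, t + n%:~R + d[%classic.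
(* [r] bounds [g ^+ 2] from below on [I]; it is clipped at 0 so that the comparison of nonnegative
   integrals applies. *)
pose r := Num.max 0 (v n ^+ 2 - 2 * e n ^+ 2) / 2.
have r0 : 0 <= r by rewrite divr_ge0// le_max lexx.
have hI : ((r * d)%:E <= \int[mu]_(x in tile n) ((g x) ^+ 2)%:E)%E.
  apply: (@le_trans _ _ (\int[mu]_(x in I) ((g x) ^+ 2)%:E)%E); last first.
    apply: ge0_subset_integral; [exact: measurable_itv|exact: measurable_itv| | |].
    - apply/measurable_EFinP/measurable_funX; exact: measurable_funTS.
    - by move=> x _; rewrite lee_fin sqr_ge0.
    - move=> x; rewrite /I /tile /= !in_itv /= => /andP[h1 h2]; apply/andP; split; lra.
  have e1 : ((r * d)%:E = \int[mu]_(x in I) (cst r%:E) x)%E.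
    by rewrite integral_cst_co ?lerDl ?ltW// addrAC subrr add0r.
  rewrite e1; apply: ge0_le_integral.
  - exact: measurable_itv.
  - by move=> x _; rewrite lee_fin.
  - exact: measurable_cst.
  - apply/measurable_EFinP/measurable_funX; exact: measurable_funTS.
  - move=> x; rewrite /I /= in_itv /= => /h hx; rewrite lee_fin /r ler_pdivrMr//.
    by rewrite ge_max mulr_ge0 ?sqr_ge0//=; lra.
apply: (@le_trans _ _ ((r * d)%:E + d%:E * (e n ^+ 2)%:E)%E); last by apply: leeD.
rewrite -!EFinM -EFinD lee_fin.
have h2 : v n ^+ 2 - 2 * e n ^+ 2 <= 2 * r.
  by rewrite /r [2 * (_ / 2)]mulrC divfK// le_max lexx orbT.
have := ler_wpM2l (ltW d0) h2; lra.
Qed.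

End Tiles.

(** * Equivalence of the coefficient norm and the L^2 norm *)

Section Riesz.
Variables (R : realType) (m : nat).
Implicit Types (x y : R) (c : int -> R) (n : int).
Local Notation M := m.+2.
Local Notation Q := (@Q R).

Lemma measurable_spl c : measurable_fun setT (spl m c).
Proof.
apply: (@measurable_fun_cvg _ _ _ _ (fun N x => psum (Q M) c x N)); last first.
  by move=> x _; exact: psum_spl.
move=> N; apply: continuous_measurable_fun => x.
apply: cvg_big => // [|i _]; first exact: add_continuous.
have cs (k : int) : continuous (fun x : R => c k * Q M (x - k%:~R)).
  move=> z; apply: cvgM; first exact: cvg_cst.
  apply: (@continuous_comp _ _ _ (fun z : R => z - k%:~R) (Q M)); last exact: Q_continuous.
  by apply: cvgB; [exact: cvg_id|exact: cvg_cst].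
by apply: cvgD; exact: cs.
Qed.

Lemma sqn_abs c : sqn (fun n => `|c n|) = sqn c.
Proof. by apply: eq_esum => n _; rewrite -normrX ger0_norm// sqr_ge0. Qed.

(** On each tile the spline is dominated by the convolution of [|c|] with a constant polynomial,
    where [B] bounds [Q M]. *)
Lemma riesz_upper : exists2 K : R, 0 < K & forall c,
  (L2sq (spl m c) <= K%:E * sqn c)%E.
Proof.
have [B B0 hB] := @Q_bounded R m.+1.
have [K K0 hK] := sqn_act (\poly_(j < M) B).
exists K => // c; rewrite -(sqn_abs c); apply: le_trans (hK _).
apply: L2sq_tiles_le; first exact: measurable_spl.
move=> n x /tileP <-; rewrite act_poly.
rewrite -[leLHS]ger0_norm ?sqr_ge0// normrX ler_sqr ?nnegrE//; last first.
  by apply: sumr_ge0 => j _; rewrite mulr_ge0.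
rewrite /spl act_Epol; apply: (le_trans (ler_norm_sum _ _ _)).
by apply: ler_sum => j _; rewrite normrM; apply: ler_wpM2r.
Qed.

Lemma Q_uniform (t eta : R) : 0 < eta -> exists2 d : R, 0 < d &
  forall (j : 'I_M) x, t <= x < t + d -> `|Q M (x + j%:R) - Q M (t + j%:R)| <= eta.
Proof.
move=> eta0.
have : forall j : 'I_M, exists d : R, 0 < d /\
    forall x, t <= x < t + d -> `|Q M (x + j%:R) - Q M (t + j%:R)| <= eta.
  move=> j; have := @Q_continuous R m (t + j%:R).
  move=> /cvgrPdist_le/(_ _ eta0)/nbhs_ballP[d /= d0 hd]; exists d; split => // x.
  move=> /andP[h1 h2]; rewrite distrC; apply: hd.
  by rewrite /ball /= ltr_norml; apply/andP; split; lra.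
move=> /choice[d hd]; exists (\big[Num.min/1]_(j < M) d j).
  by apply: lt_bigmin => // j _; have [] := hd j.
move=> j x /andP[h1 h2]; have [_] := hd j; apply; rewrite h1 /=.
apply: (lt_le_trans h2); rewrite lerD2l; exact: bigmin_le_cond.
Qed.

(** Samples at the points [t + n] already control [c]. On [t + n, t + n + d[ the spline differs from
    its sample by at most [eta] times a sum of [M] values of [|c|], so integrating over these
    intervals recovers the samples up to a small error. *)
Lemma riesz_lower : exists2 K : R, 0 < K & forall c, l2 c ->
  (sqn c <= K%:E * L2sq (spl m c))%E.
Proof.
pose t : R := fracpart (M%:R / 2).
have t01 : 0 <= t <= 1 / 2.
  by rewrite /t fracpart_half; case: (odd M) => /=; rewrite ?mul0r; lra.
have [K0 K00 hK0] := @samples_stable R m 0 ltac:(rewrite normr0; lra).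
have [K1 K10 hK1] := sqn_act (\poly_(j < M) (1 : R)).
(* The choice makes 4 K0 K1 eta^2 <= 1, so the error term absorbs at most half of [sqn c]; the cap
   at 1 gives eta^2 <= eta. *)
pose eta : R := Num.min 1 ((4 * K0 * K1)^-1).
have eta0 : 0 < eta by rewrite lt_min ltr01 invr_gt0 !mulr_gt0.
have eta2 : 4 * K0 * K1 * eta ^+ 2 <= 1.
  have h1 : eta <= 1 by rewrite ge_min lexx.
  have h2 : 4 * K0 * K1 * eta <= 1.
    have p : 0 < 4 * K0 * K1 by rewrite !mulr_gt0.
    by rewrite mulrC -ler_pdivlMr// div1r ge_min lexx orbT.
  have h3 : 0 <= 4 * K0 * K1 * eta by rewrite !mulr_ge0// ltW.
  by rewrite expr2 mulrA; apply: le_trans h2; rewrite ler_piMr.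
have [d' d'0 hd'] := Q_uniform t eta0.
(* With [t <= 1 / 2], the cap at 1/2 keeps [t, t + d[ inside one tile. *)
pose d := Num.min d' (1 / 2); have d0 : 0 < d by rewrite lt_min d'0; lra.
have dd' : d <= d' by rewrite ge_min lexx.
have d2 : d <= 1 / 2 by rewrite ge_min lexx orbT.
exists (4 * K0 / d); first by rewrite divr_gt0// mulr_gt0.
move=> c lc; pose q := act (\poly_(j < M) (1 : R)) (fun n => `|c n|).
pose e n := eta * q n.
have bnd : ((d / 2)%:E * sqn (samples m 0 c) <= L2sq (spl m c) + d%:E * sqn e)%E.
  apply: (@L2sq_tiles_ge _ _ _ _ t) => //; [exact: measurable_spl|lra|lra|].
  move=> n x /andP[x1 x2].
  have -> : samples m 0 c n = spl m c (t + n%:~R).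
    by rewrite /samples LambdaE add0r if_same.
  pose x' := x - n%:~R.
  have -> : x = x' + n%:~R by rewrite /x' subrK.
  have hx' : t <= x' < t + d by rewrite /x'; lra.
  rewrite !spl_add; [|lra|lra].
  set a := act _ _ _; set b := act _ _ _.
  have hab : `|b - a| <= e n.
    rewrite /a /b !act_Epol -sumrB /e /q act_poly mulr_sumr.
    apply: (le_trans (ler_norm_sum _ _ _)); apply: ler_sum => j _.
    rewrite -mulrBl normrM mul1r; apply: ler_wpM2r => //; apply: hd'.
    by case/andP: hx' => -> h /=; apply: (lt_le_trans h); rewrite lerD2l.
  have h1 : (b - a) ^+ 2 <= e n ^+ 2.
    rewrite -[leLHS]ger0_norm ?sqr_ge0// normrX ler_sqr ?nnegrE//.
    exact: le_trans hab.
  by have := sqr_ge0 (2 * b - a); nra.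
have be : (sqn e <= (eta ^+ 2 * K1)%:E * sqn c)%E.
  apply: (@le_trans _ _ ((eta ^+ 2)%:E * sqn q)%E).
    by apply: sqn_dom; rewrite ?sqr_ge0// => n; rewrite /e exprMn.
  rewrite (EFinM _ K1) -muleA; apply: lee_wpmul2l; first by rewrite lee_fin sqr_ge0.
  by rewrite -(sqn_abs c); exact: hK1.
have bc := hK0 c lc.
have lX := sqn_fin lc; move: be bc bnd; rewrite lX; set X := fine _ => be bc bnd.
have X0 : 0 <= X by apply: fine_ge0; exact: sqn_ge0.
have ls : l2 (samples m 0 c).
  by have [Ks _ hKs] := @sqn_samples_le R m 0; exact: sqn_le_l2 (hKs c) lc.
have le : l2 e.
  by rewrite l2E; apply: (le_lt_trans be); rewrite -EFinM ltry.
move: be bc bnd; rewrite (sqn_fin ls) (sqn_fin le).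
set S := fine (sqn (samples _ _ _)); set E := fine (sqn e).
rewrite -!EFinM !lee_fin => be bc.
have : (0 <= L2sq (spl m c))%E by apply: integral_ge0 => x _; rewrite lee_fin sqr_ge0.
case: (L2sq (spl m c)) => [L| |] // _.
- rewrite -EFinD -EFinM !lee_fin => bnd.
  have h1 : d * X <= K0 * (d * S) by rewrite mulrCA ler_pM2l.
  have h2 : K0 * (d / 2 * S) <= K0 * (L + d * E) by rewrite ler_pM2l.
  have h3 : (2 * K0 * d) * E <= (2 * K0 * d) * (eta ^+ 2 * K1 * X).
    by apply: ler_wpM2l => //; rewrite !mulr_ge0// ltW.
  have h4 : (d / 2 * X) * (4 * K0 * K1 * eta ^+ 2) <= (d / 2 * X) * 1.
    by apply: ler_wpM2l => //; rewrite mulr_ge0//; lra.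
  rewrite mulrAC ler_pdivlMr//; lra.
- by move=> _; rewrite gt0_muley ?leey// lte_fin divr_gt0// mulr_gt0.
Qed.

End Riesz.

(** * Complete interpolation *)

Section CompleteInterpolation.
Variables (R : realType) (m : nat).
Implicit Types (alpha x y : R) (c : int -> R) (n k : int).
Local Notation M := m.+2.
Local Notation Q := (@Q R).
Local Notation th := (fracpart (M%:R / 2 : R)).

Lemma inVE (f : R -> R) : inV (Q M) f -> exists2 c, l2 c & f = spl m c.
Proof. by move=> /inV_spl[c lc e]; exists c => //; apply/funext. Qed.

Lemma inV_splT c : l2 c -> inV (Q M) (spl m c).
Proof. by move=> lc; apply/inV_spl; exists c. Qed.

Lemma complete_interpolation_lt_half alpha : `|alpha| < 1 / 2 ->
  complete_interpolation (Q M) (Lambda M alpha).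
Proof.
move=> ha; split; last first.
  move=> y ly; have [c lc e] := samples_onto m ha ly.
  by exists (spl m c); split; [exact: inV_splT|move=> n; rewrite -e].
have [K K0 hK] := samples_stable m ha; have [K' K'0 hK'] := sqn_samples_le m alpha.
have [Ku Ku0 hu] := riesz_upper R m; have [Kl Kl0 hl] := riesz_lower R m.
exists ((Ku * K)^-1), (K' * Kl); split; first by rewrite invr_gt0 mulr_gt0.
split; first exact: mulr_gt0.
move=> f /inVE[c lc ->]; rewrite -[\esum_(_ in _) _]/(sqn (samples m alpha c)); split.
  apply: (@le_trans _ _ (((Ku * K)^-1)%:E * (Ku%:E * (K%:E * sqn (samples m alpha c))))%E).
    apply: lee_wpmul2l; first by rewrite lee_fin invr_ge0 mulr_ge0// ltW.
    apply: (le_trans (hu c)); apply: lee_wpmul2l; first by rewrite lee_fin ltW.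
    exact: hK.
  by rewrite !muleA -!EFinM -mulrA mulVf ?mul1e// mulf_neq0// gt_eqF.
apply: (le_trans (hK' c)); rewrite EFinM -muleA; apply: lee_wpmul2l.
  by rewrite lee_fin ltW.
exact: hl.
Qed.

Definition delta (k0 : int) : int -> R := fun n => if n == k0 then 1 else 0.

Lemma sqn_delta (k0 : int) : sqn (delta k0) = 1%E.
Proof.
have <- : \esum_(n in [set k0]) (1%:E : \bar R) = 1%E by rewrite esum_set1// lee_fin.
rewrite esum_mkcond; apply: eq_esum => n _; rewrite /delta.
case: eqVneq => [->|nk]; first by rewrite mem_set// expr1n.
by rewrite memNset ?expr0n// => /eqP; rewrite (negbTE nk).
Qed.

Lemma l2_delta (k0 : int) : l2 (delta k0).
Proof. by rewrite l2E sqn_delta ltry. Qed.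

Lemma spl0 c x : (forall n, c n = 0) -> spl m c x = 0.
Proof. by move=> h; rewrite /spl /act big1// => j _; rewrite h mulr0. Qed.

Lemma samples_translate alpha (N : int) c n :
  samples m (alpha + N%:~R) c n =
  if 0 <= n then spl m c (th + n%:~R) else spl m c (alpha + th + (n + N)%:~R).
Proof.
rewrite /samples LambdaE; case: ifP => // _; congr (spl m c _).
by rewrite intrD; ring.
Qed.

Lemma samplesE alpha c n : samples m alpha c n =
  if 0 <= n then spl m c (th + n%:~R) else spl m c (alpha + th + n%:~R).
Proof. by rewrite /samples LambdaE; case: ifP. Qed.

(* The samples on [Lambda (alpha + N)] with index other than [-1] already include
   all the samples on [Lambda alpha], so they determine the remaining one. *)
Lemma not_interpolation_translate alpha (N : int) : `|alpha| < 1 / 2 -> 1 <= N ->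
  ~ interpolation (Q M) (Lambda M (alpha + N%:~R)).
Proof.
move=> ha N1 /(_ _ (l2_delta (-1)))[f [/inVE[c lc ->] e]].
have {}e n : samples m (alpha + N%:~R) c n = delta (-1) n by exact: e.
have [K K0 hK] := samples_stable m ha.
have z : sqn (samples m alpha c) = 0%E.
  apply: sqn0 => n; rewrite samplesE; have := e n; rewrite samples_translate.
  case: ifPn => n0; first by move=> ->; rewrite /delta ifF//; lia.
  have := e (n - N); rewrite samples_translate subrK ifF; last lia.
  by move=> -> _; rewrite /delta ifF//; lia.
have c0 : forall n, c n = 0 by apply: sqn_eq0; apply: (le_trans (hK c lc)); rewrite z mule0.
by have := e (-1); rewrite /samples spl0// /delta eqxx => /esym/eqP; rewrite oner_eq0.
Qed.

(* Every point of [Lambda (alpha + N)] lies in [Lambda alpha], but the point of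
   [Lambda alpha] with index [-1] is missed. *)
Lemma not_stable_translate alpha (N : int) : `|alpha| < 1 / 2 -> N <= -1 ->
  ~ stable_sampling (Q M) (Lambda M (alpha + N%:~R)).
Proof.
move=> ha N1 [A [B [A0 [B0 st]]]].
have [c lc e] := samples_onto m ha (l2_delta (-1)).
have {}e n : samples m alpha c n = delta (-1) n by rewrite e.
have [+ _] := st _ (inV_splT lc).
rewrite -[\esum_(_ in _) _]/(sqn (samples m (alpha + N%:~R) c)) sqn0; last first.
  move=> n; rewrite samples_translate; case: ifPn => n0.
    by have := e n; rewrite samplesE n0 => ->; rewrite /delta ifF//; lia.
  have := e (n + N); rewrite samplesE ifF; last lia.
  by move=> ->; rewrite /delta ifF//; lia.
rewrite pmule_rle0 ?lte_fin// => L0.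
have [K K0 hK] := riesz_lower R m.
have c0 : forall n, c n = 0.
  apply: sqn_eq0; apply: (le_trans (hK c lc)).
  by rewrite pmule_rle0 ?lte_fin.
by have := e (-1); rewrite /samples spl0// /delta eqxx => /esym/eqP; rewrite oner_eq0.
Qed.

(** The window lies below [- M], out of reach of the rows [n >= 0], which only involve indices above
    [- M]. *)
Definition altwin (W : nat) : int -> R := fun n =>
  if (- (W + M)%:Z <= n) && (n < - M%:Z) then (-1) ^+ `|n|%N else 0.

Lemma sqn_altwin (W : nat) : sqn (altwin W) = (W%:R)%:E.
Proof.
elim: W => [|W IH].
  by rewrite sqn0// => n; rewrite /altwin ifF//; lia.
rewrite -natr1 EFinD -IH -(sqn_delta (- (W.+1 + M)%:Z)) -esumD; last 2 first.
- by move=> n _; rewrite lee_fin sqr_ge0.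
- by move=> n _; rewrite lee_fin sqr_ge0.
apply: eq_esum => n _; rewrite -EFinD /altwin /delta; congr (_%:E).
have [->|nk] := eqVneq n (- (W.+1 + M)%:Z).
  rewrite [in X in _ = X + _]ifF; last lia.
  by rewrite ifT ?sqrr_sign ?expr0n ?add0r ?expr1n//; lia.
rewrite [0 ^+ 2]expr0n addr0; congr (_ ^+ 2).
by congr (if _ then _ else _); lia.
Qed.

(** Consecutive terms cancel except at the two ends of the window, so the bound does not depend on
    [W]. *)
Lemma sqn_altwin_diff (W : nat) :
  (sqn (fun n => (altwin W n + altwin W (n - 1))%R) <= 2%:E)%E.
Proof.
apply: (@le_trans _ _ (1%:E * sqn (delta (- (W + M)%:Z)) + 1%:E * sqn (delta (- M%:Z)))%E).
  apply: sqn_comb => // n; rewrite !mul1r /altwin /delta.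
  have sg (k : nat) : ((-1) ^+ k : R) ^+ 2 = 1 by exact: sqrr_sign.
  case: ifPn => h1; case: ifPn => h2; rewrite ?addr0 ?add0r ?sg.
  - have -> : `|n - 1|%N = `|n|.+1 by lia.
    by rewrite (exprS _ `|n|%N) mulN1r subrr expr0n addr_ge0// sqr_ge0.
  - by rewrite ifT ?expr1n ?lerDl ?sqr_ge0//; lia.
  - by rewrite [in X in _ <= _ + X]ifT ?expr1n ?lerDr ?sqr_ge0//; lia.
  - by rewrite expr0n addr_ge0// sqr_ge0.
by rewrite !sqn_delta !mul1e -EFinD.
Qed.

Lemma act_sum (p : {poly R}) c n :
  act p c (n - 1) + act p c n = act p (fun k => c k + c (k - 1)) n.
Proof.
rewrite /act -big_split/=; apply: eq_bigr => j _.
by rewrite -mulrDr addrC (addrAC n).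
Qed.

(* The symbol vanishes at [-1], so the alternating sequences on long windows are
   almost in the kernel. *)
Lemma not_stable_gsum0 alpha : gsum M (fracpart (alpha + th)) = 0 ->
  ~ stable_sampling (Q M) (Lambda M alpha).
Proof.
move=> g0 [A [B [A0 [B0 st]]]].
have [p ep] : exists p, Epol M (fracpart (alpha + th)) = p * ('X - (-1)%:P).
  by apply/factor_theorem; rewrite /root horner_Epol g0.
have [K K0 hK] := sqn_act p; have [Kl Kl0 hl] := riesz_lower R m.
set s := Num.floor (alpha + th).
(* Dividing the symbol by [z + 1] leaves a bounded operator applied to the sums of neighbouring
   terms; hence this bound is uniform in [W], whereas [sqn (altwin W)] is [W]. *)
have bound W : (sqn (samples m alpha (altwin W)) <= (K * 2)%:E)%E.
  pose b n := act p (fun k => altwin W k + altwin W (k - 1)) (n + s).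
  apply: (@le_trans _ _ (1%:E * sqn b)%E); last first.
    rewrite mul1e /b sqn_shift; apply: (le_trans (hK _)); rewrite EFinM.
    by apply: lee_wpmul2l; [rewrite lee_fin ltW|exact: sqn_altwin_diff].
  apply: sqn_dom => // n; rewrite mul1r samplesE; case: ifPn => n0.
    rewrite spl_add; last by have := fracpart_itv (M%:R / 2 : R); lra.
    rewrite act_Epol big1 ?expr0n ?sqr_ge0// => j _.
    by rewrite /altwin ifF ?mulr0//; have := ltn_ord j; lia.
  by rewrite spl_shift ep mulrC act_XsubC mulN1r opprK act_sum (addrC (Num.floor _)).
have key (W : nat) : A * W%:R <= Kl * (K * 2).
  have lc : l2 (altwin W) by rewrite l2E sqn_altwin ltry.
  have [h _] := st _ (inV_splT lc).
  rewrite -lee_fin EFinM; have := hl _ lc; rewrite sqn_altwin => h2.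
  apply: (@le_trans _ _ (A%:E * (Kl%:E * L2sq (spl m (altwin W))))%E).
    by apply: lee_wpmul2l => //; rewrite lee_fin ltW.
  rewrite muleCA (EFinM Kl); apply: lee_wpmul2l; first by rewrite lee_fin ltW.
  exact: le_trans h (bound W).
have C0 : 0 <= Kl * (K * 2) / A by rewrite divr_ge0 ?mulr_ge0// ltW.
have := archi_boundP C0; rewrite ltNge ler_pdivlMr// mulrC.
by rewrite key.
Qed.

(** Modulo 1 the offset is 0 for odd order and 1/2 for even order, and these are zeros of [gsum]. *)
Lemma gsum_half_integer (N : int) : gsum M (fracpart (-1 / 2 + N%:~R + th)) = 0.
Proof.
have fr (y : R) (k : int) : 0 <= y < 1 -> fracpart (y + k%:~R) = y.
  move=> y01; rewrite /fracpart (_ : Num.floor _ = k) ?addrK//.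
  by apply: floor_def; rewrite intrD1; lra.
rewrite fracpart_half; have [oM|eM] := boolP (odd M).
  have [p eM] : exists p, M = p.*2.+3 by exists m./2; lia.
  rewrite (_ : _ + _ = 0 + N%:~R); last by rewrite -[true%:R]/(1%R : R); field.
  by rewrite fr ?lexx ?ltr01// eM gsum_odd0.
have [p eM'] : exists p, M = p.*2.+2 by exists m./2; lia.
rewrite (_ : _ + _ = 1 / 2 + (N - 1)%:~R); last by rewrite intrB -[false%:R]/(0%R : R); field.
by rewrite fr ?eM' ?gsum_half//; lra.
Qed.

End CompleteInterpolation.

Theorem theorem5p2 (R : realType) (m : nat) (alpha : R) (hm : (2 <= m)%N) :
  complete_interpolation (@Q R m) (@Lambda R m alpha) <-> `|alpha| < 1 / 2.
Proof.
case: m hm => [|[|m]] // _; split; last exact: complete_interpolation_lt_half.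
(* [N] is [alpha] rounded to the nearest integer, halves upwards, so the half-integers are exactly
   the case [a0 = - (1 / 2)]. A negative [N] destroys stability and a positive one interpolation. *)
move=> [st ip]; pose N := Num.floor (alpha + 1 / 2); pose a0 := alpha - N%:~R.
have ea : alpha = a0 + N%:~R by rewrite /a0 subrK.
have ha0 : - (1 / 2) <= a0 < 1 / 2.
  have := floor_le_tmp (alpha + 1 / 2); have := floorD1_gt (alpha + 1 / 2).
  by rewrite intrD1 -/N /a0; lra.
have [h|h] := eqVneq a0 (- (1 / 2)).
  exfalso; apply: (@not_stable_gsum0 R m alpha) => //.
  by rewrite ea h -mulNr gsum_half_integer.
have la0 : `|a0| < 1 / 2.
  by rewrite ltr_norml lt_neqAle eq_sym h.
have [N0|N0|N0] := ltgtP N 0.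
- by exfalso; apply: (@not_stable_translate R m a0 N) => //; rewrite -ea.
- by exfalso; apply: (@not_interpolation_translate R m a0 N) => //; rewrite -ea.
- by rewrite ea N0 addr0.
Qed.
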